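(* Let $\alpha = \{ \alpha_g : R_{g^{-1}} \rightarrow R_g \}_{g \in \mathrm{mor}(G)}$ be a global unital action of a groupoid $G$ on a non-associative ring $R$. Then the partial skew groupoid ring $R \star_{\alpha} G$ is left (respectively right) artinian if and only if $R$ is left (respectively right) artinian and $R_g = \{0\}$ for all but finitely many $g \in \mathrm{mor}(G)$.
   Context: Rings. A ''non-associative ring'' is an additive abelian group with a multiplication that is distributive over addition; it is not assumed associative or unital. If a ring is unital, its identity is assumed non-zero. A left (right) ideal is an additive subgroup closed under left (right) multiplication by all ring elements; a ring is left (right) artinian if it satisfies the descending chain condition on left (right) ideals. ''Ideal'' means two-sided ideal. Groupoids. A groupoid $G$ is a small category in which all morphisms are isomorphisms; $\mathrm{ob}(G)$ and $\mathrm{mor}(G)$ are its sets of objects and morphisms, and objects are identified with their identity morphisms, so $\mathrm{ob}(G)\subseteq \mathrm{mor}(G)$. For $g\in\mathrm{mor}(G)$, $d(g)$ and $c(g)$ are its domain and codomain, and $G^2$ is the set of composable pairs $(g,h)$, i.e. those with $d(g)=c(h)$. Partial actions. A partial action of $G$ on $R$ is a family $\alpha = \{ \alpha_g : R_{g^{-1}} \to R_g \}_{g \in \mathrm{mor}(G)}$ such that for each $g$, $R_{c(g)}$ is an ideal of $R$, $R_g$ is an ideal of $R_{c(g)}$, $\alpha_g$ is a ring isomorphism, and: (P1) $\alpha_e=\mathrm{id}_{R_e}$ for $e\in\mathrm{ob}(G)$; (P2) if $(g,h)\in G^2$ then $R_{(gh)^{-1}}\supseteq \alpha_h^{-1}(R_h\cap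 R_{g^{-1}})$; (P3) if $(g,h)\in G^2$ and $x\in\alpha_h^{-1}(R_h\cap R_{g^{-1}})$ then $\alpha_g(\alpha_h(x))=\alpha_{gh}(x)$; (P4) $R=\bigoplus_{e\in\mathrm{ob}(G)}R_e$. It is unital if every non-zero $R_g$ is a unital ring. It is global if $\alpha_{gh}=\alpha_g\alpha_h$ for all $(g,h)\in G^2$; equivalently, $R_g=R_{c(g)}$ for all $g\in\mathrm{mor}(G)$. The partial skew groupoid ring $R\star_\alpha G$ is the set of finite formal sums $\sum_{g\in\mathrm{mor}(G)} r_g\delta_g$ with $r_g\in R_g$, with componentwise addition and multiplication determined by $(r_g\delta_g)(r'_h\delta_h)=\alpha_g(\alpha_{g^{-1}}(r_g)r'_h)\delta_{gh}$ if $(g,h)\in G^2$, and $0$ otherwise. *)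

(* Defs.v *)
From HB Require Import structures.
From mathcomp Require Import all_boot all_order all_algebra.
From mathcomp Require Import all_classical.

Set Implicit Arguments.
Unset Strict Implicit.
Unset Printing Implicit Defensive.

Import GRing.Theory.
Local Open Scope classical_set_scope.
Local Open Scope ring_scope.

Reserved Notation "x ** y" (at level 40, left associativity).

HB.mixin Record Zmodule_isNonAssocRing R of GRing.Zmodule R := {
  namul : R -> R -> R;
  namulDl : left_distributive namul +%R;
  namulDr : right_distributive namul +%R;
}.

#[short(type="nonAssocRingType")]
HB.structure Definition NonAssocRing :=
  {R of Zmodule_isNonAssocRing R & GRing.Zmodule R}.

Notation "x ** y" := (namul x y) : ring_scope.

Section NonAssocRingTheory.
Variable R : nonAssocRingType.
Implicit Types (x y : R) (A I : set R).

Lemma namul0r y : 0 ** y = 0 :> R.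
Proof. by apply: (@addrI _ (0 ** y)); rewrite -namulDl !addr0. Qed.

Lemma namulr0 x : x ** 0 = 0 :> R.
Proof. by apply: (@addrI _ (x ** 0)); rewrite -namulDr !addr0. Qed.

Definition left_ideal I : Prop :=
  zmod_closed [in I] /\ (forall a x, I x -> I (a ** x)).

Definition right_ideal I : Prop :=
  zmod_closed [in I] /\ (forall a x, I x -> I (x ** a)).

(* [A] is meant to be a subring of [R]; [ideal_in [set: R] I] says that [I] is
   a two-sided ideal of [R]. *)
Definition ideal_in A I : Prop :=
  [/\ I `<=` A, zmod_closed [in I],
      (forall a x, A a -> I x -> I (a ** x)) &
      (forall a x, A a -> I x -> I (x ** a))].

Definition unital_on A : Prop :=
  exists u, [/\ A u, u != 0 & forall x, A x -> u ** x = x /\ x ** u = x].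

Definition ring_iso_on A B (f : R -> R) : Prop :=
  [/\ set_bij A B f,
      {in A &, {morph f : x y / x + y}} &
      {in A &, {morph f : x y / x ** y}}].

End NonAssocRingTheory.

Definition descending_chain_condition (T : Type) (P : set (set T)) : Prop :=
  forall I : nat -> set T, (forall n, P (I n)) ->
    (forall n, I n.+1 `<=` I n) ->
    exists n, forall m, (n <= m)%N -> I m = I n.

Definition left_artinian (R : nonAssocRingType) : Prop :=
  descending_chain_condition (@left_ideal R).

Definition right_artinian (R : nonAssocRingType) : Prop :=
  descending_chain_condition (@right_ideal R).

Definition finitely_supported (I : Type) (V : zmodType) (f : I -> V) : Prop :=
  finite_set (f @^-1` [set~ 0]).

Definition internal_direct_sum (I : choiceType) (V : zmodType)
    (A : I -> set V) : Prop :=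
  forall x : V, exists! f : I -> V,
    [/\ finitely_supported f, (forall i, A i (f i)) &
        x = \sum_(i \in [set: I]) f i].

(* Composition is a total function whose values are only constrained (and only
   used) on composable pairs; [gcomp g h] is "g after h". *)
Record groupoid := Groupoid {
  ob : choiceType;
  mor : choiceType;
  gdom : mor -> ob;
  gcod : mor -> ob;
  gid : ob -> mor;
  gcomp : mor -> mor -> mor;
  ginv : mor -> mor;
  gdom_id : forall e, gdom (gid e) = e;
  gcod_id : forall e, gcod (gid e) = e;
  gdom_comp : forall g h, gdom g = gcod h -> gdom (gcomp g h) = gdom h;
  gcod_comp : forall g h, gdom g = gcod h -> gcod (gcomp g h) = gcod g;
  gcompA : forall g h k, gdom g = gcod h -> gdom h = gcod k ->
    gcomp g (gcomp h k) = gcomp (gcomp g h) k;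
  gcomp1g : forall g, gcomp (gid (gcod g)) g = g;
  gcompg1 : forall g, gcomp g (gid (gdom g)) = g;
  gdom_inv : forall g, gdom (ginv g) = gcod g;
  gcod_inv : forall g, gcod (ginv g) = gdom g;
  gcompgV : forall g, gcomp g (ginv g) = gid (gcod g);
  gcompVg : forall g, gcomp (ginv g) g = gid (gdom g)
}.

Arguments gdom {G} _ : rename.
Arguments gcod {G} _ : rename.
Arguments gid {G} _ : rename.
Arguments gcomp {G} _ _ : rename.
Arguments ginv {G} _ : rename.

Definition composable (G : groupoid) (g h : mor G) : Prop := gdom g = gcod h.

Section GroupoidTheory.
Variable G : groupoid.
Implicit Types g h : mor G.

Lemma ginvK : involutive (@ginv G).
Proof.
move=> g.
rewrite -[LHS]gcompg1 gdom_inv gcod_inv -gcompVg.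
by rewrite gcompA ?gdom_inv ?gcod_inv// gcompVg gdom_inv gcomp1g.
Qed.

Lemma ginv_unique g h : composable g h -> gcomp g h = gid (gcod g) -> h = ginv g.
Proof.
move=> gh e; rewrite -[RHS]gcompg1 gdom_inv -e.
by rewrite gcompA ?gdom_inv// gcompVg gh gcomp1g.
Qed.

Lemma ginv_gid (e : ob G) : ginv (gid e) = gid e.
Proof.
apply/esym/ginv_unique; first by rewrite /composable gdom_id gcod_id.
by rewrite gcod_id -{1}(gcod_id e) gcomp1g.
Qed.

End GroupoidTheory.

(* [pdom g] is the ideal R_g, and [pact g] restricts to alpha_g on
   R_(g^-1); its values outside of R_(g^-1) are irrelevant. An object e is
   identified with the morphism [gid e]. *)
Record partial_action (G : groupoid) (R : nonAssocRingType) := PartialAction {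
  pdom : mor G -> set R;
  pact : mor G -> R -> R;
  pdom_cod_ideal : forall g, ideal_in [set: R] (pdom (gid (gcod g)));
  pdom_ideal : forall g, ideal_in (pdom (gid (gcod g))) (pdom g);
  pact_iso : forall g, ring_iso_on (pdom (ginv g)) (pdom g) (pact g);
  pact_id : forall e, {in pdom (gid e), pact (gid e) =1 id};
  pdom_comp : forall g h, composable g h ->
    pdom (ginv h) `&` pact h @^-1` (pdom h `&` pdom (ginv g))
      `<=` pdom (ginv (gcomp g h));
  pact_comp : forall g h, composable g h ->
    {in pdom (ginv h) `&` pact h @^-1` (pdom h `&` pdom (ginv g)),
      forall x, pact g (pact h x) = pact (gcomp g h) x};
  pdom_direct_sum : internal_direct_sum (fun e : ob G => pdom (gid e))
}.

Section PartialActionProperties.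
Variables (G : groupoid) (R : nonAssocRingType) (alpha : partial_action G R).

Implicit Types (g h k : mor G) (x y : R).

Lemma pdomB g x y :
  pdom alpha g x -> pdom alpha g y -> pdom alpha g (x - y).
Proof.
have [_ [_ sB] _ _] := pdom_ideal alpha g.
by move=> xg yg; have := sB x y; rewrite !inE; apply.
Qed.

Lemma pdom0 g : pdom alpha g 0.
Proof. by have [_ [+ _] _ _] := pdom_ideal alpha g; rewrite inE. Qed.

Lemma pdom_sub g x : pdom alpha g x -> pdom alpha (gid (gcod g)) x.
Proof. by have [+ _ _ _] := pdom_ideal alpha g; apply. Qed.

Lemma pdomMr g x y : pdom alpha g x -> pdom alpha (gid (gcod g)) y ->
  pdom alpha g (x ** y).
Proof. by move=> xg yg; have [_ _ _] := pdom_ideal alpha g; apply. Qed.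

Lemma pdomD g x y :
  pdom alpha g x -> pdom alpha g y -> pdom alpha g (x + y).
Proof.
move=> xg yg; rewrite -[y]opprK; apply: pdomB => //.
by rewrite -sub0r; apply: pdomB => //; exact: pdom0.
Qed.

Lemma pact_dom g x : pdom alpha (ginv g) x -> pdom alpha g (pact alpha g x).
Proof. by have [[/(_ x)/= + _ _] _ _] := pact_iso alpha g; apply. Qed.

Lemma pactV_dom g x :
  pdom alpha g x -> pdom alpha (ginv g) (pact alpha (ginv g) x).
Proof. by move=> xg; apply: pact_dom; rewrite ginvK. Qed.

Lemma pactD g x y : pdom alpha (ginv g) x -> pdom alpha (ginv g) y ->
  pact alpha g (x + y) = pact alpha g x + pact alpha g y.
Proof. by move=> xg yg; have [_ + _] := pact_iso alpha g; apply; rewrite inE. Qed.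

Lemma pact0 g : pact alpha g 0 = 0.
Proof.
apply: (@addrI _ (pact alpha g 0)).
by rewrite -pactD ?addr0//; exact: pdom0.
Qed.

Definition unital_action : Prop :=
  forall g, pdom alpha g <> [set 0] -> unital_on (pdom alpha g).

(* alpha_(gh) = alpha_g alpha_h as partial maps: the domains agree, and so do
   the values on the common domain. *)
Definition global_action : Prop :=
  forall g h, composable g h ->
    pdom alpha (ginv (gcomp g h))
      = pdom alpha (ginv h) `&` pact alpha h @^-1` (pdom alpha h `&` pdom alpha (ginv g))
    /\ {in pdom alpha (ginv (gcomp g h)),
         forall x, pact alpha (gcomp g h) x = pact alpha g (pact alpha h x)}.

Lemma global_actionP :
  global_action <-> forall g, pdom alpha g = pdom alpha (gid (gcod g)).
Proof.
split=> [gl g|eqR g h gh].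
  apply/seteqP; split=> x; first exact: pdom_sub.
  have gV : composable g (ginv g) by rewrite /composable gcod_inv.
  have [+ _] := gl _ _ gV; rewrite gcompgV ginv_gid ginvK => ->.
  by case.
have dE : pdom alpha (ginv (gcomp g h)) = pdom alpha (ginv h).
  by rewrite eqR [RHS]eqR !gcod_inv gdom_comp.
have domE : pdom alpha (ginv (gcomp g h))
    = pdom alpha (ginv h)
        `&` pact alpha h @^-1` (pdom alpha h `&` pdom alpha (ginv g)).
  rewrite dE; apply/seteqP; split=> x => [xh|[]//]; split=> //=.
  have hx := pact_dom xh; split=> //.
  by rewrite eqR gcod_inv gh -eqR.
by split=> // x; rewrite domE => xin; rewrite pact_comp.
Qed.

End PartialActionProperties.

Section SkewGroupoidRing.
Variables (G : groupoid) (R : nonAssocRingType) (alpha : partial_action G R).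
Implicit Types (f : mor G -> R) (g h k : mor G).

(* The formal sum of the r_g delta_g is the function mapping g to r_g. *)
Definition skew_pred : {pred mor G -> R} :=
  fun f => `[< finitely_supported f /\ forall g, pdom alpha g (f g) >].

Record skew_groupoid_ring := SkewGroupoidRing {
  skew_coef :> mor G -> R;
  skew_coefP : skew_coef \in skew_pred
}.

HB.instance Definition _ := [isSub for skew_coef].
HB.instance Definition _ := [Choice of skew_groupoid_ring by <:].

Lemma skew_predP f :
  reflect (finitely_supported f /\ forall g, pdom alpha g (f g))
          (f \in skew_pred).
Proof. exact: asboolP. Qed.

Lemma skew_pred_zmod_closed : zmod_closed skew_pred.
Proof.
split=> [|f1 f2 /skew_predP[fin1 p1] /skew_predP[fin2 p2]]; apply/skew_predP.
  split=> [|g]; last exact: pdom0.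
  rewrite /finitely_supported (_ : _ @^-1` _ = set0)//.
  by apply/seteqP; split=> g //=; apply.
split=> [|g]; last exact: pdomB.
apply: (@sub_finite_set _ _ (f1 @^-1` [set~ 0] `|` f2 @^-1` [set~ 0])).
  move=> g /= fg; apply: contrapT => /not_orP[/contrapT f1g /contrapT f2g].
  by apply: fg; rewrite -[LHS]/(f1 g - f2 g) f1g f2g subrr.
by rewrite finite_setU.
Qed.

HB.instance Definition _ :=
  GRing.isZmodClosed.Build (mor G -> R) skew_pred skew_pred_zmod_closed.
HB.instance Definition _ := [SubChoice_isSubZmodule of skew_groupoid_ring by <:].

Definition skew_term g x y : R :=
  pact alpha g (pact alpha (ginv g) x ** y).

Definition comp_fiber k : set (mor G * mor G) :=
  [set p | composable p.1 p.2 /\ gcomp p.1 p.2 = k].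

(* Coefficient at k of the bilinear extension of
   (r delta_g)(s delta_h) = alpha_g(alpha_(g^-1)(r) s) delta_(gh);
   only finitely many summands are non-zero. See [skew_monomialM] and
   [skew_monomialM0] below. *)
Definition skew_mul_coef f1 f2 k : R :=
  \sum_(p \in comp_fiber k) skew_term p.1 (f1 p.1) (f2 p.2).

Lemma skew_term0l g y : skew_term g 0 y = 0.
Proof. by rewrite /skew_term pact0 namul0r pact0. Qed.

Lemma skew_term0r g x : skew_term g x 0 = 0.
Proof. by rewrite /skew_term namulr0 pact0. Qed.

Lemma skew_term_in g h x y : composable g h ->
  pdom alpha g x -> pdom alpha h y ->
  pdom alpha (ginv g) (pact alpha (ginv g) x ** y).
Proof.
move=> gh xg yh; apply: pdomMr; first exact: pactV_dom.
by rewrite gcod_inv gh; exact: pdom_sub.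
Qed.

Lemma skew_term_dom g h x y : composable g h ->
  pdom alpha g x -> pdom alpha h y -> pdom alpha (gcomp g h) (skew_term g x y).
Proof.
move=> gh xg yh; set z := pact alpha (ginv g) x ** y.
have zg : pdom alpha (ginv g) z by exact: skew_term_in yh.
have zh : pdom alpha h z.
  have [_ _ + _] := pdom_ideal alpha h; apply=> //.
  by rewrite -gh -gcod_inv; apply: pdom_sub; exact: pactV_dom.
have cVg : composable (ginv (gcomp g h)) g.
  by rewrite /composable gdom_inv gcod_comp.
have zE : z = pact alpha h (pact alpha (ginv h) z).
  have cc : composable h (ginv h) by rewrite /composable gcod_inv.
  rewrite (pact_comp cc) ?gcompgV ?pact_id ?inE//.
    exact: pdom_sub.
  by split; rewrite ?ginvK//=; split; exact: pactV_dom.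
rewrite /skew_term -/z zE (pact_comp gh).
  apply: pact_dom; apply: (pdom_comp gh); split; first exact: pactV_dom.
  by rewrite /= -zE.
by rewrite inE; split; [exact: pactV_dom|rewrite /= -zE].
Qed.

Lemma skew_termDl g h x1 x2 y : composable g h ->
  pdom alpha g x1 -> pdom alpha g x2 -> pdom alpha h y ->
  skew_term g (x1 + x2) y = skew_term g x1 y + skew_term g x2 y.
Proof.
move=> gh x1g x2g yh; rewrite /skew_term pactD ?ginvK// namulDl.
by rewrite pactD//; exact: skew_term_in yh.
Qed.

Lemma skew_termDr g h x y1 y2 : composable g h ->
  pdom alpha g x -> pdom alpha h y1 -> pdom alpha h y2 ->
  skew_term g x (y1 + y2) = skew_term g x y1 + skew_term g x y2.
Proof.
move=> gh xg y1h y2h; rewrite /skew_term namulDr pactD//.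
  exact: skew_term_in y1h.
exact: skew_term_in y2h.
Qed.

Lemma skew_mul_coefE (A B : set (mor G)) f1 f2 k :
  f1 @^-1` [set~ 0] `<=` A -> f2 @^-1` [set~ 0] `<=` B ->
  skew_mul_coef f1 f2 k
    = \sum_(p \in comp_fiber k `&` (A `*` B)) skew_term p.1 (f1 p.1) (f2 p.2).
Proof.
move=> f1A f2B; apply/esym/fsbig_widen; first exact: subIsetl.
move=> [g h] [pk] /= nAB.
have [->|/eqP f1g] := eqVneq (f1 g) 0; first exact: skew_term0l.
have [->|/eqP f2h] := eqVneq (f2 h) 0; first exact: skew_term0r.
by exfalso; apply: nAB; split=> //; split; [exact: f1A|exact: f2B].
Qed.

Lemma pdom_fsum (P : set (mor G * mor G)) (F : mor G * mor G -> R) k :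
  (forall p, P p -> pdom alpha k (F p)) ->
  pdom alpha k (\sum_(p \in P) F p).
Proof.
move=> PF; case: finite_supportP => [_|X XP _ _].
  by rewrite big_nil; exact: pdom0.
rewrite big_seq; elim/big_ind: _ => [|x y|p pX].
- exact: pdom0.
- exact: pdomD.
- by apply: PF; exact: XP.
Qed.

Lemma skew_mul_pred (u v : skew_groupoid_ring) :
  skew_mul_coef u v \in skew_pred.
Proof.
have [finu du] := skew_predP _ (skew_coefP u).
have [finv dv] := skew_predP _ (skew_coefP v).
apply/skew_predP; split=> [|k].
  apply: (@sub_finite_set _ _ ((fun p => gcomp p.1 p.2) @`
      (u @^-1` [set~ 0] `*` v @^-1` [set~ 0]))).
    move=> k /= uvk; apply: contrapT => nk; apply: uvk.
    rewrite (@skew_mul_coefE (u @^-1` [set~ 0]) (v @^-1` [set~ 0]))//.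
    apply: fsbig1 => p [[_ pk] uvp]; exfalso; apply: nk.
    by exists p.
  by apply: finite_image; exact: finite_setX.
by apply: pdom_fsum => -[g h] [/= gh <-]; exact: skew_term_dom.
Qed.

Definition skew_mul (u v : skew_groupoid_ring) : skew_groupoid_ring :=
  SkewGroupoidRing (skew_mul_pred u v).

Lemma skew_mulDl : left_distributive skew_mul +%R.
Proof.
move=> u1 u2 v; apply: val_inj; apply: funext => k.
have [fin1 d1] := skew_predP _ (skew_coefP u1).
have [fin2 d2] := skew_predP _ (skew_coefP u2).
have [finv dv] := skew_predP _ (skew_coefP v).
pose A := u1 @^-1` [set~ 0] `|` u2 @^-1` [set~ 0].
pose B := v @^-1` [set~ 0].
rewrite [RHS]/= -[RHS]/(skew_mul_coef u1 v k + skew_mul_coef u2 v k).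
rewrite -[LHS]/(skew_mul_coef (fun g => u1 g + u2 g) v k).
rewrite !(@skew_mul_coefE A B)//; last first.
- by move=> g /= n0; apply: contrapT => /not_orP[/contrapT e1 /contrapT e2];
    apply: n0; rewrite e1 e2 addr0.
- by move=> g; left.
- by move=> g; right.
rewrite -fsbig_split//; last first.
  by apply: finite_setIr; apply: finite_setX => //; rewrite finite_setU.
apply: eq_fsbigr => -[g h]; rewrite inE => -[[/= gh _] _].
exact: skew_termDl gh (d1 g) (d2 g) (dv h).
Qed.

Lemma skew_mulDr : right_distributive skew_mul +%R.
Proof.
move=> u v1 v2; apply: val_inj; apply: funext => k.
have [finu du] := skew_predP _ (skew_coefP u).
have [fin1 d1] := skew_predP _ (skew_coefP v1).
have [fin2 d2] := skew_predP _ (skew_coefP v2).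
pose A := u @^-1` [set~ 0].
pose B := v1 @^-1` [set~ 0] `|` v2 @^-1` [set~ 0].
rewrite [RHS]/= -[RHS]/(skew_mul_coef u v1 k + skew_mul_coef u v2 k).
rewrite -[LHS]/(skew_mul_coef u (fun g => v1 g + v2 g) k).
rewrite !(@skew_mul_coefE A B)//; last first.
- by move=> g /= n0; apply: contrapT => /not_orP[/contrapT e1 /contrapT e2];
    apply: n0; rewrite e1 e2 addr0.
- by move=> g; left.
- by move=> g; right.
rewrite -fsbig_split//; last first.
  by apply: finite_setIr; apply: finite_setX => //; rewrite finite_setU.
apply: eq_fsbigr => -[g h]; rewrite inE => -[[/= gh _] _].
exact: skew_termDr gh (du g) (d1 h) (d2 h).
Qed.

HB.instance Definition _ :=
  Zmodule_isNonAssocRing.Build skew_groupoid_ring skew_mulDl skew_mulDr.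

Definition skew_monomial_coef g (x : R) : mor G -> R :=
  fun k => if k == g then x else 0.

Lemma skew_monomial_pred g x : pdom alpha g x ->
  skew_monomial_coef g x \in skew_pred.
Proof.
move=> xg; apply/skew_predP; split=> [|k].
  apply: (@sub_finite_set _ _ [set g]) => // k /=.
  by rewrite /skew_monomial_coef; case: (eqVneq k g).
by rewrite /skew_monomial_coef; case: (eqVneq k g) => [->//|_]; exact: pdom0.
Qed.

Definition skew_monomial g x (xg : pdom alpha g x) : skew_groupoid_ring :=
  SkewGroupoidRing (skew_monomial_pred xg).

Lemma skew_monomialM g h x y
    (xg : pdom alpha g x) (yh : pdom alpha h y) (gh : composable g h) :
  skew_monomial xg ** skew_monomial yh
    = skew_monomial (skew_term_dom gh xg yh).
Proof.
apply: val_inj; apply: funext => k.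
rewrite -[LHS]/(skew_mul_coef (skew_monomial_coef g x)
                  (skew_monomial_coef h y) k) /=.
rewrite (@skew_mul_coefE [set g] [set h]); last first.
- by move=> k' /=; rewrite /skew_monomial_coef; case: (eqVneq k' _).
- by move=> k' /=; rewrite /skew_monomial_coef; case: (eqVneq k' _).
rewrite -[RHS]/(if k == gcomp g h then skew_term g x y else 0).
case: eqP => [->|kgh].
  rewrite (_ : _ `&` _ = [set (g, h)]).
    by rewrite fsbig_set1 /= /skew_monomial_coef !eqxx.
  apply/seteqP; split=> [[g' h'] [_ [/= -> ->]]//|_ ->].
  by do !split.
apply: fsbig1 => -[g' h'] [[_ /= gh'] [/= eg eh]]; exfalso.
by apply: kgh; rewrite -gh' eg eh.
Qed.

Lemma skew_monomialM0 g h x y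
    (xg : pdom alpha g x) (yh : pdom alpha h y) : ~ composable g h ->
  skew_monomial xg ** skew_monomial yh = 0.
Proof.
move=> ngh; apply: val_inj; apply: funext => k.
rewrite -[LHS]/(skew_mul_coef (skew_monomial_coef g x)
                  (skew_monomial_coef h y) k) /=.
rewrite (@skew_mul_coefE [set g] [set h]); last first.
- by move=> k' /=; rewrite /skew_monomial_coef; case: (eqVneq k' _).
- by move=> k' /=; rewrite /skew_monomial_coef; case: (eqVneq k' _).
apply: fsbig1 => -[g' h'] [[/= gh' _] [/= eg eh]]; exfalso.
by apply: ngh; rewrite -eg -eh.
Qed.

End SkewGroupoidRing.

(* Main.v *)
From HB Require Import structures.
Require Import Defs.
From mathcomp Require Import all_boot all_order all_algebra.
From mathcomp Require Import all_classical.

(* For a global action, [S = R * G] is [R_g delta_g] summed over [g], and left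
   ideals of [R] and of [S] control each other coefficientwise: leading
   coefficients transfer the descending chain condition from [R] to [S] when
   the support is finite, and a left ideal [I] of [R] yields the left ideal
   [{s | forall g, alpha_(g^-1)(s_g) in I}] of [S].
   If [S] is left artinian, only finitely many [R_e] are non-zero, because
   vanishing at all morphisms with domain in a given set of objects defines a
   left ideal. It remains to bound the isotropy group [H] of an object [e] with
   [R_e <> 0]. Pick a prime field [F] ('F_p if the unit [u] of [R_e] is not
   divisible by [p], the rationals if [u] is divisible by every prime) and an
   additive [phi : R -> F] with [phi u = 1]. Requiring all slices
   [h |-> psi (alpha_(g^-1)(s_(g h)))], [psi : R -> F] additive, to lie in a
   left ideal of the group algebra [F[H]] shows that [F[H]] is left artinian.
   Then [F[H]] has a non-zero element annihilated on the left by the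
   augmentation ideal; its coefficients are all equal, so [H] is finite.
   The right-hand case is the left-hand case for the opposite ring of [R],
   through the anti-isomorphism [r delta_g |-> alpha_(g^-1)(r) delta_(g^-1)]. *)

Set Implicit Arguments.
Unset Strict Implicit.
Unset Printing Implicit Defensive.

Import Order.TTheory GRing.Theory Num.Theory.
Local Open Scope classical_set_scope.
Local Open Scope ring_scope.

(** * Left ideals and chain conditions *)

Section AdditiveMaps.
Variables (U V : zmodType) (f : U -> V).

Lemma morphB0 : {morph f : x y / x - y} -> f 0 = 0.
Proof. by move=> fB; rewrite -(subrr 0) fB subrr. Qed.

Lemma morphBD : {morph f : x y / x - y} -> {morph f : x y / x + y}.
Proof.
move=> fB x y; rewrite -[y in LHS]opprK fB -[- y]sub0r fB morphB0//.
by rewrite sub0r opprK.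
Qed.

Hypothesis fD : {morph f : x y / x + y}.

Lemma morphD0 : f 0 = 0.
Proof. by apply: (@addrI _ (f 0)); rewrite -fD !addr0. Qed.

Lemma morphDB : {morph f : x y / x - y}.
Proof. by move=> x y; apply: (@addIr _ (f y)); rewrite -fD !subrK. Qed.

Lemma morphDN : {morph f : x / - x}.
Proof. by move=> x; rewrite -sub0r morphDB morphD0 sub0r. Qed.

Lemma morphDMn x n : f (x *+ n) = f x *+ n.
Proof.
by elim: n => [|n IHn]; [exact: morphD0|rewrite !mulrS fD IHn].
Qed.

Lemma morphDMz x (k : int) : f (x *~ k) = f x *~ k.
Proof.
by case: k => n; rewrite ?NegzE ?mulrNz -?pmulrn ?morphDN morphDMn.
Qed.

End AdditiveMaps.

Section Ideals.
Variable R : nonAssocRingType.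
Implicit Types (I : set R).

Lemma left_idealP I : left_ideal I <->
  [/\ I 0, forall x y, I x -> I y -> I (x - y) &
      forall a x, I x -> I (a ** x)].
Proof.
split=> [[[I0 IB] IM]|[I0 IB IM]].
  split=> // [|x y Ix Iy]; first by rewrite inE in I0.
  by have := IB x y; rewrite !inE; apply.
by split=> //; split=> [|x y]; rewrite !inE //; exact: IB.
Qed.

Lemma left_idealT : left_ideal [set: R].
Proof. by apply/left_idealP. Qed.

Lemma namulN x y : x ** - y = - (x ** y) :> R.
Proof. by apply: (@addrI _ (x ** y)); rewrite -namulDr !subrr namulr0. Qed.

Lemma namulNl x y : (- x) ** y = - (x ** y) :> R.
Proof. by apply: (@addrI _ (x ** y)); rewrite -namulDl !subrr namul0r. Qed.

Lemma namulMnl x y n : (x *+ n) ** y = (x ** y) *+ n :> R.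
Proof. by elim: n => [|n IHn]; rewrite ?namul0r// !mulrS namulDl IHn. Qed.

Lemma namulMnr x y n : x ** (y *+ n) = (x ** y) *+ n :> R.
Proof. by elim: n => [|n IHn]; rewrite ?namulr0// !mulrS namulDr IHn. Qed.

Lemma namulMzr x y (k : int) : x ** (y *~ k) = (x ** y) *~ k :> R.
Proof. by case: k => n; rewrite ?NegzE ?mulrNz -?pmulrn ?namulN namulMnr. Qed.

End Ideals.

Lemma zmod_closedD (V : zmodType) (I : set V) : I 0 ->
  (forall x y, I x -> I y -> I (x - y)) ->
  forall x y, I x -> I y -> I (x + y).
Proof.
move=> I0 IB x y Ix Iy; rewrite -[y]opprK; apply: (IB) => //.
by rewrite -sub0r; exact: IB.
Qed.

(** If no member were minimal, dependent choice would iterate strict inclusions into a descending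
    chain that never stabilises. *)
Lemma dcc_minimal (T : Type) (P Q : set (set T)) :
  descending_chain_condition P -> P `&` Q !=set0 ->
  exists2 I, (P `&` Q) I &
    forall J, P J -> Q J -> J `<=` I -> J = I.
Proof.
move=> dcc [I0 PQ0]; apply: contrapT => nmin.
have step (I : {I | (P `&` Q) I}) :
    {J : {I | (P `&` Q) I} | sval J `<=` sval I /\ sval J <> sval I}.
  apply: cid; apply: contrapT => nJ; apply: nmin; case: I nJ => I PQI /= nJ.
  exists I => // J PJ QJ JI; apply: contrapT => neq; apply: nJ.
  by exists (exist _ J (conj PJ QJ)).
pose F := fix F n := if n is m.+1 then sval (step (F m))
                     else exist (P `&` Q) I0 PQ0.
have [|n|n stab] := dcc (fun n => sval (F n)).
- by move=> n; case: (svalP (F n)).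
- by case: (svalP (step (F n))).
- by case: (svalP (step (F n))) => _; apply; exact: (stab n.+1).
Qed.

(* Symmetry and non-degeneracy of the trace replace the existence of an
   idempotent generating [L]. *)
Lemma augmentation_annihilator (B : nonAssocRingType) (F : idomainType)
    (aug : B -> F) (tr : B -> F) :
  (forall x y z : B, x ** (y ** z) = (x ** y) ** z) ->
  (forall x y, aug (x - y) = aug x - aug y) ->
  (forall x y, aug (x ** y) = aug x * aug y) ->
  (exists x, aug x != 0) ->
  (forall x y, tr (x ** y) = tr (y ** x)) ->
  tr 0 = 0 ->
  (forall x, (forall y, tr (y ** x) = 0) -> x = 0) ->
  left_artinian B ->
  exists2 b : B, b != 0 & forall x, aug x = 0 -> x ** b = 0.
Proof.
move=> mulA augB augM [x1 augx1] trC tr0 tr_nondeg art.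
have aug0 := morphB0 augB.
have idealM (L : set B) w : left_ideal L -> left_ideal [set l ** w | l in L].
  move=> /left_idealP[L0 LB LM]; apply/left_idealP; split.
  - by exists 0 => //; rewrite namul0r.
  - move=> _ _ [x Lx <-] [y Ly <-]; exists (x - y); first exact: LB.
    by rewrite namulDl namulNl.
  - by move=> a _ [x Lx <-]; exists (a ** x); [exact: LM|rewrite mulA].
have [L [idL [x Lx augx]] Lmin] :=
    dcc_minimal (Q := fun I => exists2 x, I x & aug x != 0) art
      (ex_intro _ setT (conj (left_idealT B) (ex_intro2 _ _ x1 I augx1))).
have [L0 LB LM] := (left_idealP L).1 idL.
(* [L x] contains [x ** x], whose augmentation [aug x * aug x] is non-zero in a domain, so
   minimality of [L] applies. *)
have LxE : [set l ** x | l in L] = L.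
  apply: Lmin; first exact: idealM.
    by exists (x ** x); [exists x|rewrite augM mulf_neq0].
  by move=> _ [l Ll <-]; exact: LM.
have Lfact l : L l -> exists2 l1, L l1 & l = l1 ** x.
  by rewrite -{1}LxE => -[l1 Ll1 <-]; exists l1.
have x0 : x <> 0 by move=> x0; rewrite x0 aug0 eqxx in augx.
have [l1 Ll1 xE] := Lfact _ Lx.
(* [W] is minimal among the left ideals with [W L] non-zero; the whole ring qualifies because
   [x = l1 ** x]. *)
have [W [idW WL] Wmin] :=
    dcc_minimal (Q := fun W => exists w l, [/\ W w, L l & w ** l <> 0]) art
      (ex_intro _ setT (conj (left_idealT B) (ex_intro _ l1 (ex_intro _ x
        (And3 I Lx (fun e => x0 (etrans xE e))))))).
have [W0 WB WM] := (left_idealP W).1 idW.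
(* If [L W L] vanished, writing [l = l2 ** x] and rotating [x] to the front under the trace would
   give [tr (y w l) = tr (x y w l2) = 0] for all [y], hence [w l = 0]. *)
have [l [w [l' [Ll Ww Ll' lwl']]]] : exists l w l',
    [/\ L l, W w, L l' & (l ** w) ** l' <> 0].
  apply: contrapT => LWL; have {}LWL l w l' : L l -> W w -> L l' ->
      (l ** w) ** l' = 0.
    by move=> *; apply: contrapT => ?; apply: LWL; exists l, w, l'.
  have [w [l [Ww Ll]]] := WL; apply; apply: tr_nondeg => y.
  have [l2 Ll2 ->] := Lfact _ Ll.
  rewrite mulA mulA trC 2!mulA -(mulA x) LWL//; exact: WM.
have LwE : [set l ** w | l in L] = W.
  apply: Wmin; first exact: idealM.
    by exists (l ** w), l'; split=> //; exists l.
  by move=> _ [k Lk <-]; exact: WM.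
pose L' := [set l | L l /\ aug l = 0].
have idL' : left_ideal L'.
  apply/left_idealP; split=> [|a b [La ea] [Lb eb]|a b [Lb eb]].
  - by [].
  - by split; [exact: LB|rewrite augB ea eb subrr].
  - by split; [exact: LM|rewrite augM eb mulr0].
(* Otherwise [L' w = W] contains [x w], say [x w = z w] with [z] in [L']. Then [x - z] has non-zero
   augmentation and kills [w], so by minimality all of [L] kills [w], against the choice of [l]. *)
have L'w0 k m : L' k -> L m -> (k ** w) ** m = 0.
  move=> L'k Lm; apply: contrapT => kwm.
  have L'wE : [set l ** w | l in L'] = W.
    apply: Wmin; first exact: idealM.
      by exists (k ** w), m; split=> //; exists k.
    by move=> _ [? _ <-]; exact: WM.
  have KE : [set k | L k /\ k ** w = 0] = L.
    apply: Lmin.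
    - apply/left_idealP; split=> [|a b [La ea] [Lb eb]|a b [Lb eb]].
      + by split=> //; rewrite namul0r.
      + by split; [exact: LB|rewrite namulDl namulNl ea eb subrr].
      + by split; [exact: LM|rewrite -mulA eb namulr0].
    - have : W (x ** w) by apply: WM.
      rewrite -L'wE => -[z [Lz ez] zw]; exists (x - z).
        by split; [exact: LB|rewrite namulDl namulNl zw subrr].
      by rewrite augB ez subr0.
    - by move=> ? [].
  by have := Ll; rewrite -KE => -[_ lw0]; apply: lwl'; rewrite lw0 namul0r.
exists ((l ** w) ** l'); first exact/eqP.
move=> z augz; rewrite !mulA L'w0//; split; first exact: LM.
by rewrite augM augz mul0r.
Qed.

(** * Additive functionals *)

(* For [N] maximal, every [x] satisfies [x *~ k - u *~ m \in N] for some
   [k != 0] in [F], and the functional sends [x] to [m / k]. *)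
Lemma additive_functional (V : zmodType) (F : fieldType) (u : V) (N0 : set V) :
  N0 0 -> (forall x y, N0 x -> N0 y -> N0 (x - y)) ->
  (forall (k : int) x, k%:~R = 0 :> F -> N0 (x *~ k)) ->
  (forall k : int, N0 (u *~ k) -> k%:~R = 0 :> F) ->
  exists phi : V -> F, {morph phi : x y / x + y} /\ phi u = 1.
Proof.
move=> N00 N0B N0k N0u.
pose P (N : set V) := [/\ N 0, forall x y, N x -> N y -> N (x - y),
  N0 `<=` N & forall k : int, N (u *~ k) -> k%:~R = 0 :> F].
have PN0 : P N0 by split.
have [C C0 totC|N [PN Nmax]] :=
    @Zorn_bigcup V [set X | X = set0 \/ P X].
  have [[X CX [X0 _ N0X _]]|nP] := pselect (exists2 X, C X & P X); last first.
    left; apply/seteqP; split=> // x [X CX Xx].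
    by have [XE|PX] := C0 _ CX; [rewrite XE in Xx|apply: nP; exists X].
  right; split.
  - by exists X.
  - move=> x y [Y CY Yx] [Z CZ Zy].
    have [YE|[Y0 YB NY _]] := C0 _ CY; first by rewrite YE in Yx.
    have [ZE|[Z0 ZB NZ _]] := C0 _ CZ; first by rewrite ZE in Zy.
    have [YZ|ZY] := totC _ _ CY CZ.
      by exists Z => //; apply: ZB => //; exact: YZ.
    by exists Y => //; apply: YB => //; exact: ZY.
  - by move=> x N0x; exists X => //; exact: N0X.
  - move=> k [Y CY Yk].
    by have [YE|[_ _ _]] := C0 _ CY; [rewrite YE in Yk|apply].
have {PN} [NB0 NB N0N Nu] : P N.
  case: PN => // N_0; exfalso; apply: (Nmax N0); last by right.
  by rewrite N_0; split=> // /(_ _ N00).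
have ND := zmod_closedD NB0 NB.
have NN x : N x -> N (- x) by move=> Nx; rewrite -sub0r; exact: NB.
have NMn x n : N x -> N (x *+ n).
  by move=> Nx; elim: n => [|n IHn]; rewrite ?mulr0n// mulrS; exact: ND.
have NM x (k : int) : N x -> N (x *~ k).
  by move=> Nx; case: k => n; [exact: NMn|exact/NN/NMn].
(* Otherwise adjoining the multiples of [x] to [N] would give a larger subgroup that still meets the
   condition on the multiples of [u]. *)
have ratio x : exists km : int * int, km.1%:~R != 0 :> F /\
    N (x *~ km.1 - u *~ km.2).
  apply: contrapT => nkm.
  have Nx : ~ N x.
    by move=> Nx; apply: nkm; exists (1, 0); rewrite oner_neq0 mulr0z subr0.
  pose N' := [set y | exists (k : int), N (y - x *~ k)].
  apply: (Nmax N').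
    split=> [y Ny|/(_ x) N'N]; first by exists 0; rewrite mulr0z subr0.
    by apply: Nx; apply: N'N; exists 1; rewrite mulr1z subrr.
  right; split.
  - by exists 0; rewrite mulr0z subr0.
  - move=> y z [k Nk] [m Nm]; exists (k - m).
    rewrite mulrzBr opprB [x *~ m - _]addrC addrACA [- z + _]addrC -(opprB z).
    exact: NB.
  - by move=> y /N0N Ny; exists 0; rewrite mulr0z subr0.
  - move=> m [k Nk]; apply: contrapT => /eqP m0; apply: nkm.
    exists (k, m) => /=; split; last by rewrite -opprB; exact: NN.
    apply/eqP => k0; move/eqP: m0; apply; apply: Nu.
    by rewrite -[_ *~ m](subrK (x *~ k)); apply: ND => //; exact/N0N/N0k.
pose km x := sval (cid (ratio x)).
have kmP x : (km x).1%:~R != 0 :> F /\ N (x *~ (km x).1 - u *~ (km x).2).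
  exact: (svalP (cid (ratio x))).
pose phi x : F := (km x).2%:~R / (km x).1%:~R.
(* The ratio does not depend on the pair: eliminating [x] between two pairs leaves in [N] the
   multiple of [u] by their cross difference, which must therefore vanish in [F]. *)
have phiE x (k m : int) : k%:~R != 0 :> F -> N (x *~ k - u *~ m) ->
    phi x = m%:~R / k%:~R.
  move=> k0 Nkm; have [k'0 Nkm'] := kmP x; rewrite /phi.
  apply/eqP; rewrite eqr_div // -subr_eq0 -!rmorphM -rmorphB /=.
  apply/eqP/Nu; have := NB _ _ (NM _ (km x).1 Nkm) (NM _ k Nkm').
  by rewrite !mulrzBl -!mulrzA mulrzBr [k * _]mulrC opprB addrC addrA subrK.
exists phi; split=> [x y|]; last first.
  by rewrite (@phiE u 1 1) ?oner_neq0 ?divr1 ?subrr.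
have [kx0 Nx] := kmP x; have [ky0 Ny] := kmP y.
rewrite (@phiE (x + y) ((km x).1 * (km y).1)
  ((km x).2 * (km y).1 + (km y).2 * (km x).1)).
- by rewrite rmorphD !rmorphM /= addf_div.
- by rewrite rmorphM mulf_neq0.
have := ND _ _ (NM _ (km y).1 Nx) (NM _ (km x).1 Ny).
rewrite !mulrzBl -!mulrzA addrACA -opprD -mulrzDr mulrzDl.
by rewrite [(km y).1 * (km x).1]mulrC.
Qed.

(** * Skew groupoid rings of global actions *)

Section GroupoidCancel.
Variable G : groupoid.
Implicit Types g h k : mor G.

Lemma gcompKV g h : gcod g = gcod h -> gcomp g (gcomp (ginv g) h) = h.
Proof.
by move=> gh; rewrite gcompA ?gcod_inv ?gdom_inv// gcompgV gh gcomp1g.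
Qed.

Lemma gcompVK g h : gdom g = gcod h -> gcomp (ginv g) (gcomp g h) = h.
Proof. by move=> gh; rewrite gcompA ?gdom_inv// gcompVg gh gcomp1g. Qed.

Lemma ginv_comp g h : composable g h ->
  ginv (gcomp g h) = gcomp (ginv h) (ginv g).
Proof.
move=> gh; have hVgV : gdom (ginv h) = gcod (ginv g).
  by rewrite gdom_inv gcod_inv.
apply/esym/ginv_unique.
  by rewrite /composable gdom_comp// gcod_comp// gcod_inv.
have hV : gdom h = gcod (ginv h) by rewrite gcod_inv.
have hVh : gdom h = gcod (gcomp (ginv h) (ginv g)) by rewrite gcod_comp.
rewrite -gcompA// (gcompA hV hVgV) gcompgV -gh -gcod_inv gcomp1g gcompgV.
by rewrite gcod_comp.
Qed.

End GroupoidCancel.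

Section SkewRing.
Variables (G : groupoid) (R : nonAssocRingType) (alpha : partial_action G R).
Implicit Types (g h k : mor G) (u v s : skew_groupoid_ring alpha).

Lemma skew_coefD u v g : (u + v) g = u g + v g. Proof. by []. Qed.
Lemma skew_coefB u v g : (u - v) g = u g - v g. Proof. by []. Qed.
Lemma skew_coef0 g : (0 : skew_groupoid_ring alpha) g = 0. Proof. by []. Qed.

Lemma skew_ext u v : u =1 v -> u = v.
Proof. by move=> uv; apply/val_inj/funext. Qed.

Lemma skew_coef_fin u : finite_set (u @^-1` [set~ 0]).
Proof. by have [] := skew_predP _ _ (skew_coefP u). Qed.

Lemma skew_coef_dom u g : pdom alpha g (u g).
Proof. by have [_] := skew_predP _ _ (skew_coefP u); apply. Qed.

Lemma skew_monomialE g x (xg : pdom alpha g x) k :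
  skew_monomial xg k = if k == g then x else 0.
Proof. by []. Qed.

Lemma eq_skew_monomial g h x y (xg : pdom alpha g x) (yh : pdom alpha h y) :
  g = h -> x = y -> skew_monomial xg = skew_monomial yh.
Proof.
by move=> gh xy; apply: skew_ext => k; rewrite !skew_monomialE gh xy.
Qed.

(** Induction on a list that contains the finite support, removing one monomial at a time. *)
Lemma skew_ind (P : skew_groupoid_ring alpha -> Prop) :
  P 0 -> (forall u v, P u -> P v -> P (u + v)) ->
  (forall g x (xg : pdom alpha g x), P (skew_monomial xg)) ->
  forall u, P u.
Proof.
move=> P0 PD Pm u; have /finite_seqP[r uE] := skew_coef_fin u.
have : forall g, g \notin r -> u g = 0.
  move=> g gr; apply: contrapT => ug; move/negP: gr; apply.
  by have : (u @^-1` [set~ 0]) g by []; rewrite uE.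
elim: r u {uE} => [|g r IHr] u ur.
  by rewrite (_ : u = 0)//; apply: skew_ext => g; rewrite ur.
pose m := skew_monomial (skew_coef_dom u g).
rewrite -(subrK m u); apply: PD; last exact: Pm.
apply: IHr => h hr; rewrite skew_coefB skew_monomialE.
case: eqP => [->|/eqP hg]; first by rewrite subrr.
by rewrite subr0 ur// inE negb_or hg.
Qed.

Lemma skew_left_idealP (I : set (skew_groupoid_ring alpha)) :
  I 0 -> (forall u v, I u -> I v -> I (u - v)) ->
  (forall g x (xg : pdom alpha g x) u, I u -> I (skew_monomial xg ** u)) ->
  left_ideal I.
Proof.
move=> I0 IB IM; apply/left_idealP; split=> // s u Iu.
elim/skew_ind: s => [|s1 s2 Is1 Is2|g x xg]; first by rewrite namul0r.
  by rewrite namulDl; exact: zmod_closedD.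
exact: IM.
Qed.

Hypothesis gl : global_action alpha.

Local Notation A e := (pdom alpha (gid e)).

Lemma pdomE g : pdom alpha g = A (gcod g).
Proof. exact: (global_actionP alpha).1. Qed.

Lemma pdomVE g : pdom alpha (ginv g) = A (gdom g).
Proof. by rewrite pdomE gcod_inv. Qed.

Lemma pact_cod g x : A (gdom g) x -> A (gcod g) (pact alpha g x).
Proof. by rewrite -pdomVE -pdomE; exact: pact_dom. Qed.

Lemma pact_gcomp g h x : composable g h -> A (gdom h) x ->
  pact alpha g (pact alpha h x) = pact alpha (gcomp g h) x.
Proof.
move=> gh xh; have [_ ->//] := gl gh.
by rewrite inE pdomVE gdom_comp.
Qed.

Lemma pactB g x y : A (gdom g) x -> A (gdom g) y ->
  pact alpha g (x - y) = pact alpha g x - pact alpha g y.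
Proof.
rewrite -pdomVE => xg yg; apply: (@addIr _ (pact alpha g y)).
by rewrite subrK -pactD ?subrK//; exact: pdomB.
Qed.

Lemma pactM g x y : A (gdom g) x -> A (gdom g) y ->
  pact alpha g (x ** y) = pact alpha g x ** pact alpha g y.
Proof.
rewrite -pdomVE => xg yg; have [_ _] := pact_iso alpha g.
by apply; rewrite inE.
Qed.

Lemma pactVK g x : A (gdom g) x -> pact alpha (ginv g) (pact alpha g x) = x.
Proof.
move=> xg; rewrite pact_gcomp//; last by rewrite /composable gdom_inv.
by rewrite gcompVg pact_id// inE.
Qed.

Lemma pactKV g x : A (gcod g) x -> pact alpha g (pact alpha (ginv g) x) = x.
Proof.
by rewrite -gdom_inv => xg; have := pactVK xg; rewrite ginvK.
Qed.

Lemma skew_termE g x y : A (gcod g) x -> A (gdom g) y ->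
  skew_term alpha g x y = x ** pact alpha g y.
Proof.
move=> xg yg; rewrite /skew_term pactM ?pactKV//.
by rewrite -gcod_inv; apply: pact_cod; rewrite gdom_inv.
Qed.

(** The only factorisation of [g] that starts with [k] is [(k, k^-1 g)], so a monomial translates
    coefficients. The left ideals of the skew ring below are checked through this formula. *)
Lemma skew_monomial_mulE k x (xk : pdom alpha k x) s g :
  (skew_monomial xk ** s) g =
    if gcod g == gcod k then x ** pact alpha k (s (gcomp (ginv k) g)) else 0.
Proof.
rewrite -[LHS]/(skew_mul_coef alpha (skew_monomial xk) s g).
rewrite (@skew_mul_coefE _ _ _ [set k] [set: mor G])//; last first.
  by move=> h /=; rewrite /skew_monomial_coef; case: eqP.
case: eqP => [gk|ngk].
  have kg : gdom (ginv k) = gcod g by rewrite gdom_inv.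
  rewrite (_ : _ `&` _ = [set (k, gcomp (ginv k) g)]).
    rewrite fsbig_set1 /= /skew_monomial_coef eqxx skew_termE -?pdomE//.
    have := skew_coef_dom s (gcomp (ginv k) g).
    by rewrite pdomE gcod_comp// gcod_inv.
  apply/seteqP; split=> [[k' h] [[/= kh <-] [/= k'k _]]|_ ->] /=.
    by rewrite -k'k gcompVK.
  split=> //; split=> /=; last exact: gcompKV.
  by rewrite /composable gcod_comp// gcod_inv.
rewrite fsbig1// => -[k' h] [[/= kh ghE] [/= k'k _]].
by exfalso; apply: ngk; rewrite -ghE -k'k gcod_comp.
Qed.

End SkewRing.

Lemma decreasing_le (T : Type) (I : nat -> set T) :
  (forall n, I n.+1 `<=` I n) -> forall n m, (n <= m)%N -> I m `<=` I n.
Proof.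
move=> dec n m /subnK <-; elim: (m - n)%N => [|k IHk]; first exact: subset_refl.
by rewrite addSn; apply: subset_trans IHk; exact: dec.
Qed.

(** * Chain conditions and supports for global actions *)

Section GlobalAction.
Variables (G : groupoid) (R : nonAssocRingType) (alpha : partial_action G R).
Implicit Types (g h k : mor G) (u v s : skew_groupoid_ring alpha).

Hypothesis gl : global_action alpha.

Local Notation A e := (pdom alpha (gid e)).

(** Both [x] placed at [e] alone and [x] placed at [f] alone decompose [x], and decompositions are
    unique. *)
Lemma pdom_disjoint e f x : e != f -> A e x -> A f x -> x = 0.
Proof.
move=> ef xe xf; have [phi [_ uniq_phi]] := pdom_direct_sum alpha x.
pose d (i j : ob G) := if j == i then x else 0 : R.
have dP i : A i x -> phi = d i.
  move=> xi; apply: uniq_phi; split=> [|j|].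
  - apply: (@sub_finite_set _ _ [set i]) => // j /=.
    by rewrite /d; case: (eqVneq j i).
  - by rewrite /d; case: (eqVneq j i) => [->//|_]; exact: pdom0.
  - rewrite -(@fsbig_widen _ _ _ _ [set i])//.
      by rewrite fsbig_set1 /d eqxx.
    by move=> j [_ /= ji]; rewrite /d; case: eqP.
have := congr1 (fun psi => psi e) (dP f xf).
by rewrite (dP e xe) /d eqxx (negbTE ef).
Qed.

Lemma pdom_mull e a x : A e x -> A e (a ** x).
Proof.
have [_ _ + _] := pdom_cod_ideal alpha (gid e).
by rewrite gcod_id; apply.
Qed.

Lemma pdom_mulr e a x : A e x -> A e (x ** a).
Proof.
have [_ _ _] := pdom_cod_ideal alpha (gid e).
by rewrite gcod_id; apply.
Qed.

Lemma pdomM0 e f x y : e != f -> A e x -> A f y -> x ** y = 0.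
Proof.
move=> ef xe yf; apply: (pdom_disjoint ef); first exact: pdom_mulr.
exact: pdom_mull.
Qed.

Lemma pdom_decomp x : exists (r : seq (ob G)) (f : ob G -> R),
  [/\ uniq r, forall e, A e (f e) & x = \sum_(e <- r) f e].
Proof.
have [f [[_ fA ->] _]] := pdom_direct_sum alpha x.
by exists (finite_support 0 [set: ob G] f), f; split.
Qed.

(** The components of [a] in the other summands annihilate [R_e]; hence multiplication by an
    arbitrary ring element can be imitated in the skew ring by a monomial at an identity. *)
Lemma pdom_lmul e a : exists2 a', A e a' & forall x, A e x -> a ** x = a' ** x.
Proof.
have [r [f [_ fA ->]]] := pdom_decomp a.
elim: r => [|i r [a' ea' a'E]].
  by exists 0; [exact: pdom0|move=> x _; rewrite big_nil].
have [ei|ei] := eqVneq i e; [exists (f e + a')|exists a'] => //.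
- exact: pdomD.
- by move=> x ex; rewrite big_cons !namulDl a'E// ei.
- by move=> x ex; rewrite big_cons namulDl a'E// (pdomM0 ei)// add0r.
Qed.

(* With local units, every left ideal is the sum of its intersections with
   the summands [R_e]. *)
Lemma left_ideal_sub (unital : unital_action alpha) (I J : set R) :
  left_ideal I -> left_ideal J ->
  (forall e x, A e x -> I x -> J x) -> I `<=` J.
Proof.
move=> /left_idealP[_ _ IM] /left_idealP[J0 JB _] IJ x.
have [r [f [ur fA xE]]] := pdom_decomp x; move=> Ix.
rewrite xE big_seq; elim/big_ind: _ => // [y z|e er]; first exact: zmod_closedD.
apply: (IJ e) => //.
have [A0|/unital[u [ue _ uid]]] := pselect (A e = [set 0]).
  by have := fA e; rewrite A0 => ->; rewrite -(namul0r x); exact: IM.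
suff <- : u ** x = f e by exact: IM.
rewrite xE (big_morph _ (namulDr u) (namulr0 u)) (bigD1_seq e)//= big1.
  by rewrite addr0; have [] := uid _ (fA e).
by move=> i ie; apply: (pdomM0 _ ue (fA i)); rewrite eq_sym.
Qed.

Lemma skew_left_artinian :
  left_artinian R -> finite_set [set g : mor G | pdom alpha g <> [set 0]] ->
  left_artinian (skew_groupoid_ring alpha).
Proof.
move=> artR /finite_seqP[gs gsE] I idI decI.
have s0 s g : g \notin gs -> s g = 0.
  move=> ggs; apply: contrapT => sg; move/negP: ggs; apply.
  suff : [set h | pdom alpha h <> [set 0]] g by rewrite gsE.
  by move=> /= g0; have := skew_coef_dom s g; rewrite g0.
have decIle := decreasing_le decI.
pose Z (p : seq (mor G)) :=
  [set s : skew_groupoid_ring alpha | forall g, g \in p -> s g = 0].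
(* The elements considered already vanish on [p], while [q] lists the positions still to be
   treated. *)
suff: forall q p, (forall g, g \in gs -> g \in p ++ q) ->
    exists n, forall m, (n <= m)%N -> I n `&` Z p `<=` I m.
  move=> /(_ gs [::])[//|n nP]; exists n => m nm; apply/seteqP; split.
    exact: decIle.
  by move=> s Is; apply: (nP m nm).
elim=> [|g q IHq] p pq.
  exists 0%N => m _ s [_ Zs]; rewrite (_ : s = 0).
    by have /left_idealP[] := idI m.
  apply: skew_ext => g; have [/pq|/s0->//] := boolP (g \in gs).
  by rewrite cats0 => /Zs.
pose C n := [set x | exists2 s, (I n `&` Z p) s & s g = x].
have idC n : left_ideal (C n).
  have /left_idealP[I0 IB IM] := idI n; apply/left_idealP; split.
  - by exists 0.
  - move=> _ _ [s [Is Zs] <-] [t [It Zt] <-]; exists (s - t) => //; split.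
      exact: IB.
    by move=> h hp; rewrite skew_coefB Zs// Zt// subrr.
  (* A monomial at an identity moves no position, so the zeros on [p] persist. *)
  - move=> a _ [s [Is Zs] <-]; have [a' ea' a'E] := pdom_lmul (gcod g) a.
    exists (skew_monomial ea' ** s).
      split=> [|h hp]; first exact: IM.
      rewrite skew_monomial_mulE// gcod_id ginv_gid; case: eqP => // <-.
      by rewrite gcomp1g Zs// pact0 namulr0.
    have sg : A (gcod g) (s g) by rewrite -pdomE//; exact: skew_coef_dom.
    rewrite skew_monomial_mulE// gcod_id ginv_gid eqxx gcomp1g.
    by rewrite pact_id ?inE// a'E.
have [|n1 n1P] := artR C idC.
  by move=> n _ [s [Is Zs] <-]; exists s => //; split=> //; exact: decI.
have [|n2 n2P] := IHq (g :: p).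
  by move=> h /pq; rewrite !mem_cat !inE orbCA orbA.
exists (maxn n1 n2) => m; rewrite geq_max => /andP[n1m n2m] s [Is Zs].
(* Stability of [C] provides [t] in [I m] with the same coefficient at [g]; then [s - t] vanishes at
   [g] too and falls under the induction hypothesis. *)
have : C (maxn n1 n2) (s g) by exists s.
rewrite n1P ?leq_maxl// -(n1P m)// => -[t [It Zt] tg].
have [_ IB _] := (left_idealP (I m)).1 (idI m).
have [I0' IB' _] := (left_idealP (I n2)).1 (idI n2).
rewrite -(subrK t s); apply: zmod_closedD => //.
  by have /left_idealP[] := idI m.
apply: (n2P m n2m); split.
  apply: IB'; last exact: decIle It.
  by apply: decIle Is; rewrite leq_maxr.
move=> h; rewrite inE skew_coefB => /predU1P[->|hp]; first by rewrite tg subrr.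
by rewrite Zs// Zt// subrr.
Qed.

(** [J n] is stable because alpha_(g^-1) alpha_k = alpha_((k^-1 g)^-1). Monomials at identities
    recover from [J n] the part of [I n] in each [R_e], and by local units these parts determine
    [I n]. *)
Lemma left_artinian_base (unital : unital_action alpha) :
  left_artinian (skew_groupoid_ring alpha) -> left_artinian R.
Proof.
move=> art I idI decI.
pose J n := [set s : skew_groupoid_ring alpha |
  forall g, I n (pact alpha (ginv g) (s g))].
have sV s g : A (gdom (ginv g)) (s g).
  by rewrite gdom_inv -pdomE//; exact: skew_coef_dom.
have idJ n : left_ideal (J n).
  have /left_idealP[I0 IB IM] := idI n; apply: skew_left_idealP.
  - by move=> g; rewrite skew_coef0 pact0.
  - move=> s t Js Jt g; rewrite skew_coefB pactB//; exact: IB.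
  - move=> k x xk s Js g; rewrite skew_monomial_mulE//.
    case: eqP => [gk|_]; last by rewrite pact0.
    have kVg : composable (ginv k) g by rewrite /composable gdom_inv.
    have scod : A (gdom k) (s (gcomp (ginv k) g)).
      by rewrite -gcod_inv -(gcod_comp kVg) -pdomE//; exact: skew_coef_dom.
    rewrite pactM ?gdom_inv ?gk//; last 2 first.
    + by rewrite -pdomE.
    + exact: pact_cod.
    apply: IM; rewrite pact_gcomp//; last by rewrite /composable gdom_inv.
    have -> : gcomp (ginv g) k = ginv (gcomp (ginv k) g).
      by rewrite ginv_comp// ginvK.
    exact: Js.
have [|n nP] := art J idJ; first by move=> n s Js g; apply: decI.
exists n => m nm; apply/seteqP.
have JI i j : J i = J j -> I i `<=` I j.
  move=> Jij; apply: left_ideal_sub => // e x ex Ix.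
  have : J i (skew_monomial ex).
    have /left_idealP[I0 _ _] := idI i.
    move=> g; rewrite skew_monomialE.
    case: eqP => [->|_]; last by rewrite pact0.
    by rewrite ginv_gid pact_id ?inE.
  rewrite Jij => /(_ (gid e)).
  by rewrite skew_monomialE eqxx ginv_gid pact_id ?inE.
by split; apply: JI; rewrite nP.
Qed.

(** Translating a position on the left keeps its domain, so [J D] is a left ideal. At a minimal
    [J D], imposing one more object [e] changes nothing, so the monomials at the identity of [e]
    vanish. *)
Lemma finite_nonzero_objects :
  left_artinian (skew_groupoid_ring alpha) ->
  finite_set [set e : ob G | A e <> [set 0]].
Proof.
move=> art.
pose J (D : seq (ob G)) := [set s : skew_groupoid_ring alpha |
  forall g, gdom g \in D -> s g = 0].
have idJ D : left_ideal (J D).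
  apply: skew_left_idealP => [//|s t Js Jt g gD|k x xk s Js g gD].
    by rewrite skew_coefB Js// Jt// subrr.
  rewrite skew_monomial_mulE//; case: eqP => // gk.
  by rewrite Js ?pact0 ?namulr0// gdom_comp// gdom_inv.
have [_ [_ [D ->]] Jmin] := dcc_minimal (Q := fun I => exists D, I = J D) art
  (ex_intro _ (J [::]) (conj (idJ _) (ex_intro _ [::] erefl))).
apply: (@sub_finite_set _ _ [set` D]) => [e|]; last exact: finite_seq.
apply: contra_notP => /= eD.
apply/seteqP; split=> [x ex|_ ->]; last exact: pdom0.
have : J D (skew_monomial ex).
  move=> g gD; rewrite skew_monomialE; case: eqP => // gE.
  by rewrite gE gdom_id in gD.
rewrite -(Jmin (J (e :: D)))//.
- by move=> /(_ (gid e)); rewrite gdom_id mem_head skew_monomialE eqxx; apply.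
- by exists (e :: D).
- by move=> s Js g gD; apply: Js; rewrite inE gD orbT.
Qed.

(** As alpha_g is bijective, a non-zero [R_g] forces non-zero ideals at both ends of [g]. The
    morphisms from [e] to [f] are a single one composed with the isotropy at [e]. *)
Lemma finite_support_of_isotropy :
  finite_set [set e : ob G | A e <> [set 0]] ->
  (forall e, A e <> [set 0] ->
    finite_set [set g : mor G | gdom g = e /\ gcod g = e]) ->
  finite_set [set g : mor G | pdom alpha g <> [set 0]].
Proof.
move=> finE finH.
pose E := [set e : ob G | A e <> [set 0]].
pose hom (p : ob G * ob G) := [set g : mor G | gdom g = p.1 /\ gcod g = p.2].
apply: (@sub_finite_set _ _ (\bigcup_(p in E `*` E) hom p)).
  move=> g /=; rewrite pdomE// => gE; exists (gdom g, gcod g) => //; split=> //.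
  move=> /= d0; apply: gE; apply/seteqP; split=> [x gx|_ ->]; last exact: pdom0.
  rewrite -(pactKV gl gx).
  have : A (gdom g) (pact alpha (ginv g) x).
    by rewrite -gcod_inv; apply: pact_cod; rewrite ?gdom_inv.
  by rewrite d0 => ->; rewrite pact0.
apply: bigcup_finite; first exact: finite_setX.
move=> [e f] [/= Ee Ef].
have [[g0 [g0d g0c]]|nohom] := pselect (hom (e, f) !=set0); last first.
  rewrite (_ : hom (e, f) = set0)//; apply/seteqP; split=> // g gh.
  by apply: nohom; exists g.
apply: (@sub_finite_set _ _ ((fun h => gcomp g0 h) @` hom (e, e))).
  move=> g [gd gc]; exists (gcomp (ginv g0) g) => /=; last first.
    by apply: gcompKV; rewrite g0c gc.
  by split; rewrite /= ?gdom_comp ?gcod_comp ?gdom_inv ?gcod_inv ?g0c.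
exact/finite_image/finH.
Qed.

End GlobalAction.

(** * The opposite ring *)

(** A separate name for the type, so that the reversed product does not clash with the original
    instance. *)
Definition opposite (R : nonAssocRingType) : Type := R.

Section Opposite.
Variable R : nonAssocRingType.

HB.instance Definition _ := GRing.Zmodule.on (opposite R).

Fact opposite_mulDl :
  left_distributive (fun x y : opposite R => (y : R) ** (x : R)) +%R.
Proof. by move=> x y z; rewrite -namulDr. Qed.

Fact opposite_mulDr :
  right_distributive (fun x y : opposite R => (y : R) ** (x : R)) +%R.
Proof. by move=> x y z; rewrite -namulDl. Qed.

HB.instance Definition _ :=
  Zmodule_isNonAssocRing.Build (opposite R) opposite_mulDl opposite_mulDr.

End Opposite.

(** Pulling back along [f'] and then along [f] returns the original set, so no stabilisation is
    lost. *)
Lemma dcc_preimage (T U : Type) (P : set (set T)) (Q : set (set U))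
    (f : T -> U) (f' : U -> T) : cancel f f' ->
  (forall I, P I -> Q (f' @^-1` I)) ->
  descending_chain_condition Q -> descending_chain_condition P.
Proof.
move=> fK PQ dcc I PI decI.
have [n|n x|n nP] := dcc (fun n => f' @^-1` I n); first exact: PQ.
  exact: decI.
exists n => m /nP ImE.
have E i x : (f' @^-1` I i) (f x) = I i x by rewrite /preimage /= fK.
by apply/funext => x; rewrite -!E ImE.
Qed.

Lemma right_artinian_antiiso (R S : nonAssocRingType) (T : R -> S) :
  bijective T -> {morph T : x y / x - y} ->
  (forall x y, T (x ** y) = T y ** T x) ->
  right_artinian R <-> left_artinian S.
Proof.
move=> [T' TK T'K] TB TM.
have T0 := morphB0 TB.
have T'0 : T' 0 = 0 by rewrite -T0 TK.
have T'B x y : T' (x - y) = T' x - T' y.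
  by rewrite -{1}(T'K x) -{1}(T'K y) -TB TK.
have T'M x y : T' (x ** y) = T' y ** T' x.
  by rewrite -{1}(T'K x) -{1}(T'K y) -TM TK.
split; [apply: (dcc_preimage T'K)|apply: (dcc_preimage TK)] => I.
- move=> /left_idealP[I0 IB IM].
  split=> [|a x /=]; last by rewrite TM; exact: IM.
  split=> [|x y]; first by rewrite inE /= T0.
  by rewrite !inE /= TB; exact: IB.
- move=> [[I0 IB] IM]; apply/left_idealP; split=> [|x y|a x] /=.
  + by rewrite T'0; rewrite inE in I0.
  + by rewrite T'B; have := IB (T' x) (T' y); rewrite !inE.
  + by rewrite T'M; exact: IM.
Qed.

Section OppositeAction.
Variables (G : groupoid) (R : nonAssocRingType) (alpha : partial_action G R).

Fact opposite_ideal_in (A I : set R) :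
  ideal_in A I -> ideal_in (A : set (opposite R)) I.
Proof. by case=> IA Iz Il Ir; split. Qed.

Fact opposite_pact_iso g : ring_iso_on
  (pdom alpha (ginv g) : set (opposite R)) (pdom alpha g) (pact alpha g).
Proof.
have [bij D M] := pact_iso alpha g; split=> // x y xg yg; exact: M.
Qed.

(** Two-sided ideals and multiplicative maps survive the reversal of the product, so the ideals and
    maps are kept. *)
Definition opposite_action : partial_action G (opposite R) :=
  @PartialAction G (opposite R) (pdom alpha) (pact alpha)
    (fun g => opposite_ideal_in (pdom_cod_ideal alpha g))
    (fun g => opposite_ideal_in (pdom_ideal alpha g))
    opposite_pact_iso (@pact_id _ _ alpha) (@pdom_comp _ _ alpha)
    (@pact_comp _ _ alpha) (pdom_direct_sum alpha).

Lemma opposite_unital : unital_action alpha -> unital_action opposite_action.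
Proof.
move=> unital g /unital[u [ug u0 uid]]; exists u; split=> // x xg.
by have [] := uid x xg.
Qed.

Lemma opposite_global : global_action alpha -> global_action opposite_action.
Proof. by []. Qed.

End OppositeAction.

Section AntiIsomorphism.
Variables (G : groupoid) (R : nonAssocRingType) (alpha : partial_action G R).
Hypothesis gl : global_action alpha.

Local Notation S := (skew_groupoid_ring alpha).
Local Notation S' := (skew_groupoid_ring (opposite_action alpha)).

(** The anti-isomorphism read at its target: the coefficient at [g] comes from position [g^-1]. The
    same formula gives the inverse. *)
Definition skew_flip_coef (f : mor G -> R) (g : mor G) : R :=
  pact alpha g (f (ginv g)).

Fact skew_flip_pred f : f \in skew_pred alpha ->
  skew_flip_coef f \in skew_pred alpha.
Proof.
move=> /skew_predP[ffin fd]; apply/skew_predP.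
split=> [|g]; last exact: pact_dom.
apply: (@sub_finite_set _ _ (@ginv G @` (f @^-1` [set~ 0]))).
  move=> g /= fg; exists (ginv g); last by rewrite ginvK.
  by move=> fVg; apply: fg; rewrite /skew_flip_coef fVg pact0.
exact: finite_image.
Qed.

Definition skew_flip (s : S) : S' :=
  @SkewGroupoidRing G (opposite R) (opposite_action alpha) (skew_flip_coef s)
    (skew_flip_pred (skew_coefP s)).

Definition skew_unflip (s : S') : S :=
  @SkewGroupoidRing G R alpha (skew_flip_coef s)
    (skew_flip_pred (skew_coefP s)).

Lemma skew_flip_coefK f : f \in skew_pred alpha ->
  skew_flip_coef (skew_flip_coef f) =1 f.
Proof.
move=> /skew_predP[_ fd] g; rewrite /skew_flip_coef ginvK pactKV//.
by rewrite -pdomE.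
Qed.

Lemma skew_flip_bij : bijective skew_flip.
Proof.
by exists skew_unflip => s; apply: skew_ext => g;
  exact: (skew_flip_coefK (skew_coefP s)).
Qed.

Lemma skew_flipB : {morph skew_flip : s t / s - t}.
Proof.
move=> s t; apply: skew_ext => g.
apply: (pactB gl (x := s (ginv g)) (y := t (ginv g))).
  by rewrite -gcod_inv -pdomE//; exact: skew_coef_dom.
by rewrite -gcod_inv -pdomE//; exact: skew_coef_dom.
Qed.

Lemma skew_flip_monomial g x (xg : pdom alpha g x)
    (xV : pdom alpha (ginv g) (pact alpha (ginv g) x)) :
  skew_flip (skew_monomial xg)
    = @skew_monomial _ _ (opposite_action alpha) _ _ xV.
Proof.
apply: skew_ext => h; rewrite skew_monomialE.
rewrite [LHS]/(pact alpha h (skew_monomial xg (ginv h))) skew_monomialE.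
case: (eqVneq h (ginv g)) => [->|hg]; first by rewrite ginvK eqxx.
rewrite -[X in _ == X](ginvK g) (inj_eq (can_inj (@ginvK G))) (negbTE hg).
exact: (pact0 alpha h).
Qed.

(** Biadditivity reduces to monomials. For composable [g] and [h] both sides then have the
    coefficient alpha_(h^-1)(alpha_(g^-1)(x)) alpha_(h^-1)(y), with the product of [R]. *)
Lemma skew_flipM s t : skew_flip (s ** t) = skew_flip t ** skew_flip s.
Proof.
have flip0 := morphB0 skew_flipB; have flipD := morphBD skew_flipB.
elim/skew_ind: s => [|s1 s2 IH1 IH2|g x xg].
- by rewrite namul0r flip0 namulr0.
- by rewrite namulDl !flipD IH1 IH2 namulDr.
elim/skew_ind: t => [|t1 t2 IH1 IH2|h y yh].
- by rewrite namulr0 flip0 namul0r.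
- by rewrite namulDr !flipD IH1 IH2 namulDl.
rewrite !(@skew_flip_monomial _ _ _ (pactV_dom _)).
have [gh|ngh] := pselect (composable g h); last first.
  rewrite skew_monomialM0// flip0 skew_monomialM0//.
  by rewrite /composable gdom_inv gcod_inv => /esym.
have VhVg : composable (ginv h) (ginv g).
  by rewrite /composable gdom_inv gcod_inv.
have xc : pdom alpha (gid (gcod g)) x by rewrite -pdomE.
have yc : pdom alpha (gid (gcod h)) y by rewrite -pdomE.
have yd : pdom alpha (gid (gdom g)) y by rewrite gh.
have gyc := pact_cod gl yd.
have gVx : pdom alpha (gid (gdom g)) (pact alpha (ginv g) x).
  by rewrite -gcod_inv; apply: pact_cod; rewrite ?gdom_inv.
rewrite !skew_monomialM (@skew_flip_monomial _ _ _ (pactV_dom _)).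
  exact: skew_term_dom.
move=> xyd; apply: eq_skew_monomial; first exact: ginv_comp.
rewrite (skew_termE (opposite_global gl)) ?gcod_inv ?gdom_inv; last 2 first.
- rewrite -gcod_inv; by apply: (pact_cod gl); rewrite gdom_inv.
- by rewrite -gh.
rewrite skew_termE// ginv_comp// -pact_gcomp//; last first.
  by rewrite gdom_inv -pdomE//; exact: pdomMr.
rewrite pactM ?gdom_inv// pactVK// pactM ?gdom_inv -?gh//.
Qed.

End AntiIsomorphism.

(** * Group algebras *)

Definition scalars (F : fieldType) : Type := F.

Section Scalars.
Variable F : fieldType.

HB.instance Definition _ := GRing.Zmodule.on (scalars F).

HB.instance Definition _ := Zmodule_isNonAssocRing.Build (scalars F)
  (@mulrDl F : left_distributive (fun x y : scalars F => (x : F) * (y : F)) _)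
  (@mulrDr F).

End Scalars.

Section GroupAlgebra.
Variables (H : groupoid) (e0 : ob H) (obH : forall e : ob H, e = e0).
Variable F : fieldType.

Let K : nonAssocRingType := scalars F.

Fact trivial_pdom_ideal : @ideal_in K setT setT.
Proof. by split=> //; split=> [|x y]; rewrite !inE. Qed.

Fact trivial_pact_iso : @ring_iso_on K setT setT id.
Proof. by split=> //; split=> // x _; exists x. Qed.

Fact trivial_direct_sum :
  internal_direct_sum (fun _ : ob H => [set: K]).
Proof.
have sumE (f : ob H -> K) : \sum_(e \in [set: ob H]) f e = f e0.
  rewrite (_ : [set: ob H] = [set e0]) ?fsbig_set1//.
  by apply/seteqP; split=> // e _; exact: obH.
move=> x; exists (fun=> x); split=> [|f [_ _ ->]]; last first.
  by apply/funext => e; rewrite sumE [e]obH.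
split=> //; apply: (@sub_finite_set _ _ [set e0]) => // e _.
exact: obH.
Qed.

(** Presents the group algebra of a one-object groupoid as a skew groupoid ring, so that the results
    above apply to it. *)
Definition trivial_action : partial_action H K :=
  @PartialAction H K (fun=> setT) (fun=> id)
    (fun=> trivial_pdom_ideal) (fun=> trivial_pdom_ideal)
    (fun=> trivial_pact_iso) (fun _ _ _ => erefl) (fun _ _ _ _ _ => I)
    (fun _ _ _ _ _ => erefl) trivial_direct_sum.

Local Notation B := (skew_groupoid_ring trivial_action).
Implicit Types (s u v : B) (g h k : mor H) (x y : F).

Let delta k x : B := @skew_monomial _ _ trivial_action k x I.

Lemma composableT g h : composable g h.
Proof. by rewrite /composable [LHS]obH [RHS]obH. Qed.

Lemma trivial_global : global_action trivial_action.
Proof. exact/global_actionP. Qed.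

Lemma group_algebra_ind (P : B -> Prop) :
  P 0 -> (forall u v, P u -> P v -> P (u + v)) ->
  (forall g x, P (delta g x)) -> forall u, P u.
Proof.
move=> P0 PD Pm; apply: skew_ind => // g x xg.
by rewrite (_ : skew_monomial xg = delta g x)//; exact: eq_skew_monomial.
Qed.

Lemma delta_coef k x g : delta k x g = if g == k then x else 0.
Proof. by []. Qed.

Lemma delta_mulE k x s g : (delta k x ** s) g = x * s (gcomp (ginv k) g).
Proof.
rewrite (skew_monomial_mulE trivial_global).
by rewrite (obH (gcod g)) (obH (gcod k)) eqxx.
Qed.

Lemma deltaM g h x y : delta g x ** delta h y = delta (gcomp g h) (x * y).
Proof.
by rewrite (skew_monomialM _ _ (composableT g h)); exact: eq_skew_monomial.
Qed.

Lemma group_algebra_mulA s u v : s ** (u ** v) = (s ** u) ** v.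
Proof.
elim/group_algebra_ind: s => [|s1 s2 E1 E2|g x]; first by rewrite !namul0r.
  by rewrite !namulDl E1 E2.
elim/group_algebra_ind: u => [|s1 s2 E1 E2|h y].
- by rewrite namul0r !namulr0 namul0r.
- by rewrite namulDl !namulDr namulDl E1 E2.
elim/group_algebra_ind: v => [|s1 s2 E1 E2|k z]; first by rewrite !namulr0.
  by rewrite !namulDr E1 E2.
by rewrite !deltaM mulrA gcompA//; exact: composableT.
Qed.

Let augm s : F := \sum_(g \in [set: mor H]) (s g : F).

Let augmE (D : set (mor H)) s : s @^-1` [set~ 0] `<=` D ->
  augm s = \sum_(g \in D) (s g : F).
Proof.
move=> sD; apply/esym/fsbig_widen => // g [_ gD] /=.
by apply: contrapT => sg; apply: gD; exact: sD.
Qed.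

Let augmB u v : augm (u - v) = augm u - augm v.
Proof.
pose D := u @^-1` [set~ 0] `|` v @^-1` [set~ 0].
have finD : finite_set D by rewrite finite_setU; split; exact: skew_coef_fin.
suff -> : augm u = augm (u - v) + augm v by rewrite addrK.
rewrite !(@augmE D); last 3 first.
- by move=> g; right.
- move=> g /= uvg; apply: contrapT => /not_orP[/contrapT ug /contrapT vg].
  by apply: uvg; rewrite -[LHS]/(u g - v g) ug vg subrr.
- by move=> g; left.
rewrite -fsbig_split//; apply: eq_fsbigr => g _.
by rewrite -[RHS]/((u - v) g + v g) skew_coefB subrK.
Qed.

Let augm_delta k x : augm (delta k x) = x.
Proof.
rewrite (@augmE [set k]) ?fsbig_set1 ?delta_coef ?eqxx// => g /=.
by rewrite /skew_monomial_coef; case: eqP.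
Qed.

Let augmM u v : augm (u ** v) = augm u * augm v.
Proof.
have augm0 := morphB0 augmB; have augmD := morphBD augmB.
elim/group_algebra_ind: u => [|s1 s2 E1 E2|g x].
- by rewrite namul0r augm0 mul0r.
- by rewrite namulDl !augmD E1 E2 mulrDl.
elim/group_algebra_ind: v => [|s1 s2 E1 E2|h y].
- by rewrite namulr0 augm0 mulr0.
- by rewrite namulDr !augmD E1 E2 mulrDr.
by rewrite deltaM !augm_delta.
Qed.

Lemma group_algebra_left_artinian_finite :
  left_artinian B -> finite_set [set: mor H].
Proof.
(* The coefficient at the identity is a symmetric trace; it is non-degenerate because multiplying by
   the monomial at [g^-1] makes it read off the coefficient at [g]. *)
move=> art; pose tr (s : B) : F := s (gid e0).
have comp1 g : gcomp g (gid e0) = g by rewrite -(obH (gdom g)) gcompg1.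
have tr_delta k x s : tr (delta k x ** s) = x * s (ginv k).
  by rewrite /tr delta_mulE comp1.
have trC u v : tr (u ** v) = tr (v ** u).
  elim/group_algebra_ind: u => [|s1 s2 E1 E2|g x].
  - by rewrite namul0r namulr0.
  - by rewrite namulDl namulDr /tr !skew_coefD -!/(tr _) E1 E2.
  elim/group_algebra_ind: v => [|s1 s2 E1 E2|h y].
  - by rewrite namul0r namulr0.
  - by rewrite namulDl namulDr /tr !skew_coefD -!/(tr _) E1 E2.
  have gVh : (ginv h == g) = (ginv g == h).
    by apply/eqP/eqP => <-; rewrite ginvK.
  rewrite !tr_delta !delta_coef gVh; case: eqP => _; first exact: mulrC.
  by rewrite !mulr0.
have [||b b0 augb] := augmentation_annihilator group_algebra_mulA augmB augmM
    _ trC erefl _ art.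
- by exists (delta (gid e0) 1); rewrite augm_delta oner_neq0.
- move=> s trs; apply: skew_ext => g; have := trs (delta (ginv g) 1).
  by rewrite tr_delta mul1r ginvK.
(* A difference of two monomials with coefficient 1 has augmentation zero, so it kills [b]: the
   coefficients of [b] are translation invariant. *)
have bE k g : b (gcomp (ginv k) g) = b g.
  have := augb (delta k 1 - delta (gid e0) 1).
  rewrite augmB !augm_delta subrr => /(_ erefl)/(congr1 (fun s : B => s g)).
  rewrite namulDl namulNl skew_coefB !delta_mulE !mul1r ginv_gid.
  by rewrite -(obH (gcod g)) gcomp1g => /subr0_eq.
have [g bg] : exists g, b g <> 0.
  apply: contrapT => nb; move/eqP: b0; apply; apply: skew_ext => g.
  by apply: contrapT => bg; apply: nb; exists g.
apply: (@sub_finite_set _ _ (b @^-1` [set~ 0])); last exact: skew_coef_fin.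
(* Since [h = (g h^-1)^-1 g], invariance carries the non-zero coefficient at [g] to any [h]. *)
move=> h _ /=; rewrite -(bE (gcomp g (ginv h)) g) in bg.
have gVh : composable g (ginv h) := composableT _ _.
rewrite ginv_comp// ginvK -gcompA in bg; try exact: composableT.
by rewrite gcompVg (obH (gdom g)) comp1 in bg.
Qed.

End GroupAlgebra.

(** * Isotropy groups *)

Section Isotropy.
Variables (G : groupoid) (e : ob G).

Definition isotropy_mor := {g : mor G | (gdom g == e) && (gcod g == e)}.
Implicit Types g h k : isotropy_mor.

Fact isotropy_dom g : gdom (val g) = e.
Proof. by have /andP[/eqP] := valP g. Qed.

Fact isotropy_cod g : gcod (val g) = e.
Proof. by have /andP[_ /eqP] := valP g. Qed.

Fact isotropy_composable g h : composable (val g) (val h).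
Proof. by rewrite /composable isotropy_dom isotropy_cod. Qed.

Fact isotropy_id_subproof : (gdom (gid e) == e) && (gcod (gid e) == e).
Proof. by rewrite gdom_id gcod_id eqxx. Qed.

Fact isotropy_comp_subproof g h :
  (gdom (gcomp (val g) (val h)) == e) && (gcod (gcomp (val g) (val h)) == e).
Proof.
have gh := isotropy_composable g h.
by rewrite gdom_comp// gcod_comp// isotropy_dom isotropy_cod eqxx.
Qed.

Fact isotropy_inv_subproof g :
  (gdom (ginv (val g)) == e) && (gcod (ginv (val g)) == e).
Proof. by rewrite gdom_inv gcod_inv isotropy_dom isotropy_cod eqxx. Qed.

Definition isotropy_id : isotropy_mor := Sub (gid e) isotropy_id_subproof.
Definition isotropy_comp g h : isotropy_mor :=
  Sub (gcomp (val g) (val h)) (isotropy_comp_subproof g h).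
Definition isotropy_inv g : isotropy_mor :=
  Sub (ginv (val g)) (isotropy_inv_subproof g).

Fact isotropy_compA g h k :
  isotropy_comp g (isotropy_comp h k) = isotropy_comp (isotropy_comp g h) k.
Proof. by apply: val_inj; apply: gcompA; exact: isotropy_composable. Qed.

Fact isotropy_comp1g g : isotropy_comp isotropy_id g = g.
Proof. by apply: val_inj; have := gcomp1g (val g); rewrite isotropy_cod. Qed.

Fact isotropy_compg1 g : isotropy_comp g isotropy_id = g.
Proof. by apply: val_inj; have := gcompg1 (val g); rewrite isotropy_dom. Qed.

Fact isotropy_compgV g : isotropy_comp g (isotropy_inv g) = isotropy_id.
Proof. by apply: val_inj; rewrite /= gcompgV isotropy_cod. Qed.

Fact isotropy_compVg g : isotropy_comp (isotropy_inv g) g = isotropy_id.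
Proof. by apply: val_inj; rewrite /= gcompVg isotropy_dom. Qed.

Definition isotropy : groupoid :=
  @Groupoid unit isotropy_mor (fun=> tt) (fun=> tt) (fun=> isotropy_id)
    isotropy_comp isotropy_inv (fun e => let: tt := e in erefl)
    (fun e => let: tt := e in erefl) (fun _ _ _ => erefl) (fun _ _ _ => erefl)
    (fun g h k _ _ => isotropy_compA g h k) isotropy_comp1g isotropy_compg1
    (fun=> erefl) (fun=> erefl) isotropy_compgV isotropy_compVg.

Fact isotropy_ob (x : ob isotropy) : x = tt.
Proof. by case: x. Qed.

End Isotropy.

(** * Transfer to the group algebra of an isotropy group *)

Section Transfer.
Variables (G : groupoid) (R : nonAssocRingType) (alpha : partial_action G R).
Hypothesis gl : global_action alpha.
Variables (e : ob G) (F : fieldType).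

Local Notation A e := (pdom alpha (gid e)).
Local Notation S := (skew_groupoid_ring alpha).
Local Notation B := (skew_groupoid_ring (trivial_action (@isotropy_ob G e) F)).
Local Notation additive psi := {morph psi : x y / x + y}.

(** [iota c] plays the part of [c u], although [R] need not be a vector space over [F]: only its
    image under additive functionals is prescribed. *)
Variables (u : R) (iota : F -> R) (phi : R -> F).
Hypotheses (ue : A e u) (uid : forall x, A e x -> u ** x = x).
Hypotheses (iota_dom : forall c, A e (iota c)) (iota0 : iota 0 = 0).
Hypothesis iotaE : forall psi : R -> F, additive psi ->
  forall c, psi (iota c) = c * psi u.
Hypotheses (phiD : additive phi) (phiu : phi u = 1).

Definition isotropy_embed_coef (b : B) (k : mor G) : R :=
  if insub k is Some h then iota (b (h : isotropy_mor e)) else 0.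

Fact isotropy_embed_pred b : isotropy_embed_coef b \in skew_pred alpha.
Proof.
apply/skew_predP; split=> [|k]; last first.
  rewrite /isotropy_embed_coef; case: insubP => [h /andP[_ /eqP ke] _|_].
    by rewrite pdomE// ke.
  exact: pdom0.
apply: (@sub_finite_set _ _ (val @` (b @^-1` [set~ 0]))).
  move=> k /=; rewrite /isotropy_embed_coef; case: insubP => // h _ <- bh.
  by exists h => // bh0; apply: bh; rewrite bh0.
exact/finite_image/skew_coef_fin.
Qed.

Definition isotropy_embed b : S := SkewGroupoidRing (isotropy_embed_pred b).

(** Coefficients determine [b], so its existence says that the slice itself belongs to [I]. Ranging
    over all [psi] and [g] is what absorbs left multiplication. *)
Definition slice (I : set B) : set S := [set s | forall (psi : R -> F) g,
  additive psi -> gdom g = e -> exists2 b, I b &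
  forall h : isotropy_mor e,
    (b h : F) = psi (pact alpha (ginv g) (s (gcomp g (val h))))].

(** Multiplying [s] by [x delta_k] turns the slice at [psi], [g] into the slice of [s] at
    [psi (alpha_(g^-1)(x) ** _)], [k^-1 g], or into zero if the codomains of [g] and [k] differ. *)
Lemma slice_left_ideal I : left_ideal I -> left_ideal (slice I).
Proof.
move=> /left_idealP[I0 IB IM].
have zero (psi : R -> F) : additive psi -> exists2 b, I b &
    forall h : isotropy_mor e, (b h : F) = psi 0.
  by move=> psiD; exists 0 => // h; rewrite (morphD0 psiD).
have sV (s : S) g h : gdom g = gcod h ->
    A (gdom (ginv g)) (s (gcomp g h)).
  move=> gh; have := skew_coef_dom s (gcomp g h).
  by rewrite pdomE// gcod_comp// gdom_inv.
apply: skew_left_idealP.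
- move=> psi g psiD _; have [b Ib bE] := zero psi psiD.
  by exists b => // h; rewrite bE skew_coef0 pact0.
- move=> s t Js Jt psi g psiD ge.
  have [b Ib bE] := Js psi g psiD ge; have [c Ic cE] := Jt psi g psiD ge.
  exists (b - c) => [|h]; first exact: IB.
  have gh : gdom g = gcod (val h) by rewrite isotropy_cod.
  rewrite [LHS]/((b h : F) - c h) bE cE skew_coefB.
  by rewrite (pactB gl (sV s _ _ gh) (sV t _ _ gh)) (morphDB psiD).
- move=> k x xk s Js psi g psiD ge.
  have [gk|gk] := eqVneq (gcod g) (gcod k); last first.
    have [b Ib bE] := zero psi psiD; exists b => // h; rewrite bE.
    have gh : gdom g = gcod (val h) by rewrite isotropy_cod.
    by rewrite skew_monomial_mulE// gcod_comp// (negbTE gk) pact0.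
  have kVg : composable (ginv k) g by rewrite /composable gdom_inv.
  have gVk : composable (ginv g) k by rewrite /composable gdom_inv.
  pose r := pact alpha (ginv g) x.
  have [||b Ib bE] := Js (fun y => psi (r ** y)) (gcomp (ginv k) g).
  + by move=> y z; rewrite namulDr psiD.
  + by rewrite gdom_comp.
  exists b => // h; rewrite bE.
  have gh : gdom g = gcod (val h) by rewrite isotropy_cod.
  have kVgh : gdom (ginv k) = gcod (gcomp g (val h)) by rewrite gcod_comp.
  have sk : A (gdom k) (s (gcomp (ginv k) (gcomp g (val h)))).
    by have := sV s _ _ kVgh; rewrite ginvK.
  rewrite skew_monomial_mulE// gcod_comp// gk eqxx.
  rewrite -gcompA// ginv_comp// ginvK -pact_gcomp//.
  rewrite [in RHS]pactM// gdom_inv gk -?pdomE//.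
  by rewrite pdomE//; exact: pact_cod.
Qed.

Lemma left_artinian_isotropy : left_artinian S -> left_artinian B.
Proof.
move=> art I idI decI.
have [n|n s Js psi g psiD ge|n nP] := art (fun n => slice (I n)).
- exact: slice_left_ideal.
- by have [b Ib bE] := Js psi g psiD ge; exists b => //; exact: decI.
exists n => m nm; have {nP}ImE := nP m nm.
have sub i j : left_ideal (I i) -> slice (I i) = slice (I j) -> I i `<=` I j.
  move=> /left_idealP[I0 IB IM] Iij b Ib.
  have : slice (I i) (isotropy_embed b).
    move=> psi g psiD ge.
    have [ce|ce] := eqVneq (gcod g) e; last first.
      exists 0 => // h; rewrite /= /isotropy_embed_coef.
      rewrite insubN ?pact0 ?(morphD0 psiD)// gcod_comp ?isotropy_cod//.
      by rewrite (negbTE ce) andbF.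
    have gP : (gdom g == e) && (gcod g == e) by rewrite ge ce eqxx.
    pose g' : isotropy_mor e := Sub g gP.
    (* Multiplying by [u] first pushes every argument into [R_e], where alpha_(g^-1) is additive.
       The slice of the embedded [b] is then [b] translated by [g^-1] and scaled by [psi' u]. *)
    pose psi' y := psi (pact alpha (ginv g) (u ** y)).
    have psi'D : additive psi'.
      have uV y : pdom alpha (ginv (ginv g)) (u ** y).
        by rewrite ginvK pdomE// ce; exact: pdom_mulr.
      by move=> y z; rewrite /psi' namulDr pactD ?psiD.
    exists (@skew_monomial _ _ (trivial_action (@isotropy_ob G e) F)
              (isotropy_inv g') (psi' u) Logic.I ** b); first exact: IM.
    move=> h; rewrite delta_mulE.
    rewrite [ginv _](_ : _ = g'); last exact: (@ginvK (isotropy e) g').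
    rewrite /= /isotropy_embed_coef.
    have -> : gcomp g (val h) = val (isotropy_comp g' h) by [].
    rewrite valK -[iota _](uid (iota_dom _)) -/(psi' _) iotaE//.
    exact: mulrC.
  (* The slice at [phi] and the identity returns [b] itself, as [phi u = 1]. *)
  rewrite Iij => /(_ phi (gid e) phiD (gdom_id e)) [c Ic cE].
  rewrite (_ : b = c)//; apply: skew_ext => h; rewrite [RHS]cE.
  have -> : gcomp (gid e) (val h) = val h.
    by have := gcomp1g (val h); rewrite isotropy_cod.
  rewrite ginv_gid /= /isotropy_embed_coef valK.
  by rewrite pact_id ?inE// iotaE// phiu mulr1.
by apply/seteqP; split; apply: sub.
Qed.

End Transfer.

(** Functionals into a prime field are automatically linear on multiples and fractions of [u]. The
    shape [u ** a] later places the values of [iota] in the ideal [R_e]. *)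
Lemma prime_scalars (R : nonAssocRingType) (u : R) : u != 0 -> u ** u = u ->
  exists (F : fieldType) (iota : F -> R) (phi : R -> F),
    [/\ (forall c, exists a, iota c = u ** a) /\ iota 0 = 0,
        forall psi : R -> F, {morph psi : x y / x + y} ->
          forall c, psi (iota c) = c * psi u,
        {morph phi : x y / x + y} & phi u = 1].
Proof.
move=> /eqP u0 uu.
have [[p p_pr up]|div] :=
    pselect (exists2 p, prime p & forall y, u <> y *+ p).
  have zp (k : int) : (k%:~R == 0 :> 'F_p) = (p%:Z %| k)%Z.
    by rewrite (dvdz_pcharf (pchar_Fp p_pr)).
  have [||k x|k|phi [phiD phiu]] := @additive_functional R 'F_p u
      [set x | exists y, x = y *+ p].
  - by exists 0; rewrite mul0rn.
  - by move=> _ _ [x ->] [y ->]; exists (x - y); rewrite mulrnBl.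
  - move=> /eqP; rewrite zp => /dvdzP[m ->]; exists (x *~ m).
    by rewrite mulrzA.
  (* If [p] does not divide [k], a Bezout relation combines [u k = p y] into a division of [u] by
     [p]. *)
  - move=> [y uk]; apply/eqP; rewrite zp; apply: contrapT => /negP pk.
    have /eqP pk1 : coprimez p k by rewrite coprimezE /= prime_coprime.
    have [a [b abE]] := Bezoutz p k; apply: (up (u *~ a + y *~ b)).
    rewrite -[LHS]mulr1z -pk1 -abE mulrzDr [b * k]mulrC !mulrzA uk.
    by rewrite mulrnDl !pmulrn -!mulrzA [p%:Z * b]mulrC.
  (* The representative of [c] below [p] is used; a functional into 'F_p only sees its residue. *)
  exists 'F_p, (fun c : 'F_p => u *+ (c : nat)), phi; split=> //.
    by split=> // c; exists (u *+ c); rewrite namulMnr uu.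
  move=> psi psiD c; rewrite (morphDMn psiD).
  by rewrite -mulr_natl natr_Zp.
(* Divisors multiply because [u] is idempotent: [u = y *+ p] and [u = z *+ m] give
   [u = u ** u = (y ** z) *+ (p * m)]. *)
have {}div n : (0 < n)%N -> exists y, u = y *+ n.
  have [m] := ubnP n; elim: m n => // m IHm n nm n0.
  have [n1|n1] := leqP n 1.
    by exists u; rewrite (_ : n = 1%N)//; apply/eqP; rewrite eqn_leq n1.
  have [y yE] : exists y, u = y *+ pdiv n.
    apply: contrapT => ny; apply: div; exists (pdiv n); first exact: pdiv_prime.
    by move=> y yE; apply: ny; exists y.
  have [|| z zE] := IHm (n %/ pdiv n)%N.
  - rewrite -ltnS; apply: leq_trans nm.
    by rewrite ltnS ltn_Pdiv// prime_gt1// pdiv_prime.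
  - by rewrite divn_gt0 ?pdiv_gt0// dvdn_leq// pdiv_dvd.
  exists (y ** z).
  by rewrite -{1}uu {1}yE zE namulMnl namulMnr -mulrnA divnK// pdiv_dvd.
have /choice[y yE] n : exists x, (0 < n)%N -> u = x *+ n.
  by case: n => [|n]; [exists 0|have [z] := div n.+1 isT; exists z].
have [||k x|k|phi [phiD phiu]] := @additive_functional R rat u [set 0].
- by [].
- by move=> _ _ -> ->; rewrite subrr.
- by move/eqP; rewrite intr_eq0 => /eqP -> /=; rewrite mulr0z.
(* An idempotent divisible by [|k|] and killed by it is zero: [u = u ** u = y ** (u *+ |k|) = 0]. *)
- move=> /= uk; apply/eqP; rewrite intr_eq0; apply: contrapT => /negP k0.
  have uk0 : u *+ `|k|%N = 0.
    case: k uk k0 => // n; rewrite NegzE mulrNz => /eqP.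
    by rewrite oppr_eq0 => /eqP.
  apply: u0; rewrite -uu {1}(yE `|k|%N) ?absz_gt0//.
  by rewrite namulMnl -namulMnr uk0 namulr0.
exists rat, (fun q => u ** (y `|denq q|%N *~ numq q)), phi; split=> //.
  split=> [c|]; first by exists (y `|denq c|%N *~ numq c).
  by rewrite mulr0z namulr0.
move=> psi psiD q; set n := `|denq q|%N; set x := u ** (y n *~ numq q).
have n0 : (0 < n)%N by rewrite absz_gt0 denq_neq0.
have nE : n%:R = (denq q)%:~R :> rat by rewrite -[denq q]gez0_abs.
have n0Q : n%:R != 0 :> rat by rewrite pnatr_eq0 -lt0n.
(* Clearing the denominator of [q] turns [x] into an integer multiple of [u], on which [psi] is
   known. *)
have xn : x *+ n = u *~ numq q.
  by rewrite /x namulMzr pmulrn -mulrzA mulrC mulrzA -pmulrn -namulMnr -yE// uu.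
apply: (mulIf n0Q).
rewrite mulr_natr -(morphDMn psiD) xn (morphDMz psiD) mulrAC nE -numqE.
by rewrite -mulrzr mulrC.
Qed.

(** * The left-hand case and the theorem *)

Section LeftCase.
Variables (G : groupoid) (R : nonAssocRingType) (alpha : partial_action G R).
Hypotheses (unital : unital_action alpha) (gl : global_action alpha).

Lemma isotropy_finite (e : ob G) :
  left_artinian (skew_groupoid_ring alpha) ->
  pdom alpha (gid e) <> [set 0] ->
  finite_set [set g : mor G | gdom g = e /\ gcod g = e].
Proof.
move=> art /unital[u [ue u0 uid]].
have [F [iota [phi [[iotau iota0] iotaE phiD phiu]]]] :=
  prime_scalars u0 (uid u ue).1.
have iotaA c : pdom alpha (gid e) (iota c).
  by have [a ->] := iotau c; exact: pdom_mulr.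
have uidl x ex := (uid x ex).1.
have artB := left_artinian_isotropy gl ue uidl iotaA iota0 iotaE phiD phiu art.
apply: (@sub_finite_set _ _ (val @` [set: isotropy_mor e])).
  move=> g [/eqP gd /eqP gc].
  by exists (Sub g (introT andP (conj gd gc)) : isotropy_mor e).
exact/finite_image/(group_algebra_left_artinian_finite artB).
Qed.

Lemma skew_left_artinianP : left_artinian (skew_groupoid_ring alpha) <->
  left_artinian R /\ finite_set [set g : mor G | pdom alpha g <> [set 0]].
Proof.
split=> [art|[artR fin]]; last exact: skew_left_artinian.
split; first exact: left_artinian_base art.
apply: (finite_support_of_isotropy gl); first exact: finite_nonzero_objects art.
by move=> e; exact: isotropy_finite.
Qed.

End LeftCase.

Theorem theorem1p2 (G : groupoid) (R : nonAssocRingType)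
    (alpha : partial_action G R)
    (hunital : unital_action alpha) (hglobal : global_action alpha) :
  (left_artinian (skew_groupoid_ring alpha) <->
     left_artinian R /\
     finite_set [set g : mor G | pdom alpha g <> [set 0%R]])
  /\
  (right_artinian (skew_groupoid_ring alpha) <->
     right_artinian R /\
     finite_set [set g : mor G | pdom alpha g <> [set 0%R]]).
Proof.
split; first exact: skew_left_artinianP.
have flip := right_artinian_antiiso (skew_flip_bij hglobal)
  (skew_flipB hglobal) (skew_flipM hglobal).
(* By conversion, left ideals of the opposite of [R] are right ideals of [R], and the opposite
   action has the same ideals [R_g]. *)
exact: iff_trans flip
  (skew_left_artinianP (opposite_unital hunital) (opposite_global hglobal)).
Qed.
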